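(* Let $G$ be a discrete abelian group, $S=G\setminus\{0\}$, $p\in(1,\infty)$, and let $\mu,\nu\in\mathcal M$ be absolutely continuous with respect to $\lambda$ with $\mu\ll\nu$. Then either $d_p(\nu,\mu;S)=0$ or $$d_p(\mu;S)\le d_p(\nu,\mu;S)\le\infty .$$ If $d_p(\mu;S)>0$, then $d_p(\mu;S)=d_p(\nu,\mu;S)$ holds if and only if $\nu=a\mu$ for some number $a\in(0,\infty)$.
   Context: $G$ is a discrete abelian group (written additively, $G\ne\{0\}$), $\Gamma$ is its compact dual group with normalized Haar measure $\lambda$, and for $x\in G$, $e_x:\Gamma\to\mathbb C$ is the character of $\Gamma$ generated by $x$. $\mathcal M$ is the set of all non-zero finite non-negative regular Borel measures on $\Gamma$. For $S\subseteq G\setminus\{0\}$ non-empty, $\mathcal T(S)$ is the complex linear space of all finite sums $\sum_j a_je_{x_j}$, $a_j\in\mathbb C$, $x_j\in S$; $d_p(\mu;S):=\inf\{\int|1-\tau|^p\,d\mu:\tau\in\mathcal T(S)\}$; $[\mathcal T(S)]_{\mu,p}$ is the closure of $\mathcal T(S)$ in $L^p(\mu)$. For $p\in(1,\infty)$, the metric projection $\phi_{\mu,p}(S)$ is the unique element of $[\mathcal T(S)]_{\mu,p}$ with $\int|1-\phi_{\mu,p}(S)|^p\,d\mu=d_p(\mu;S)$. For $\mu\ll\nu$, $d_p(\nu,\mu;S):=\int|1-\phi_{\nu,p}(S)|^p\,d\mu\in[0,\infty]$. *)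

(* Defs.v *)
From HB Require Import structures.
From mathcomp Require Import all_boot all_order all_algebra.
From mathcomp Require Import complex.
From mathcomp Require Import all_classical all_reals all_analysis.

Set Implicit Arguments.
Unset Strict Implicit.
Unset Printing Implicit Defensive.

Import Order.TTheory GRing.Theory Num.Theory.
Import numFieldNormedType.Exports.
Import ComplexField.Normc.

Local Open Scope classical_set_scope.
Local Open Scope ring_scope.
Local Open Scope complex_scope.

(* The compact dual of the discrete group G: homomorphisms from G to the unit
   circle. As G is discrete, the compact-open topology on the dual is the
   topology of pointwise convergence, which set_type inherits from {ptws _}. *)
Definition is_character (R : realType) (G : zmodType) (g : G -> R[i]) : Prop :=
  (forall x, `|g x| = 1) /\ (forall x y, g (x + y) = g x * g y).

Definition characters (R : realType) (G : zmodType) : set {ptws G -> R[i]^o} :=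
  [set g | is_character g].

Definition dual (R : realType) (G : zmodType) : Type :=
  set_type (@characters R G).

HB.instance Definition _ (R : realType) (G : zmodType) :=
  Topological.copy (dual R G) (set_type (@characters R G)).

Section dual_group.
Context (R : realType) (G : zmodType).
Implicit Types g h : dual R G.

(* [pairing g x] is e_x(g) *)
Definition pairing g (x : G) : R[i] := set_val g x.

Lemma pairing_norm g x : `|pairing g x| = 1.
Proof. by have [] := set_mem (valP g). Qed.

Lemma pairingD g x y : pairing g (x + y) = pairing g x * pairing g y.
Proof. by have [_] := set_mem (valP g). Qed.

Lemma pairing_inj g h : (forall x, pairing g x = pairing h x) -> g = h.
Proof. by move=> gh; apply: val_inj; apply: funext. Qed.

Definition mk_dual (f : G -> R[i]) (fP : is_character f) : dual R G :=
  exist _ (f : {ptws G -> R[i]^o}) (mem_set (fP : characters f)).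

Lemma is_character1 : is_character (fun _ : G => 1 : R[i]).
Proof. by split=> [x|x y]; rewrite ?normr1 ?mulr1. Qed.

Lemma is_characterM g h : is_character (fun x => pairing g x * pairing h x).
Proof.
split=> [x|x y]; first by rewrite normrM !pairing_norm mulr1.
by rewrite !pairingD mulrACA.
Qed.

Lemma is_characterV g : is_character (fun x => (pairing g x)^-1).
Proof.
by split=> [x|x y]; rewrite ?normfV ?pairing_norm ?invr1 // pairingD invfM.
Qed.

Definition dual_one : dual R G := mk_dual is_character1.
Definition dual_mul g h : dual R G := mk_dual (is_characterM g h).
Definition dual_inv g : dual R G := mk_dual (is_characterV g).

Lemma dual_mulA : associative dual_mul.
Proof. by move=> a b c; apply: pairing_inj => x; apply: mulrA. Qed.

Lemma dual_mul1g : left_id dual_one dual_mul.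
Proof. by move=> a; apply: pairing_inj => x; apply: mul1r. Qed.

Lemma dual_mulg1 : right_id dual_one dual_mul.
Proof. by move=> a; apply: pairing_inj => x; apply: mulr1. Qed.

Lemma dual_mulVg : left_inverse dual_one dual_inv dual_mul.
Proof.
move=> a; apply: pairing_inj => x; apply: mulVf.
by rewrite -normr_gt0 pairing_norm.
Qed.

Lemma dual_mulgV : right_inverse dual_one dual_inv dual_mul.
Proof.
move=> a; apply: pairing_inj => x; apply: mulfV.
by rewrite -normr_gt0 pairing_norm.
Qed.

HB.instance Definition _ := isPointed.Build (dual R G) dual_one.
HB.instance Definition _ := isGroup.Build (dual R G)
  dual_mulA dual_mul1g dual_mulg1 dual_mulVg dual_mulgV.

End dual_group.

Notation borel T := (g_sigma_algebraType (@open T)).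

Section regular_haar.
Context (R : realType).

Definition regular (T : ptopologicalType)
    (mu : {measure set (borel T) -> \bar R}) : Prop :=
  forall A : set (borel T), measurable A ->
    mu A = ereal_inf [set mu U | U in [set U : set T | open U /\ A `<=` U]] /\
    mu A = ereal_sup [set mu K | K in [set K : set T | compact K /\ K `<=` A]].

Definition is_haar (G : zmodType) (lambda : probability (borel (dual R G)) R) :
    Prop :=
  regular lambda /\
  forall (g : dual R G) (A : set (borel (dual R G))), measurable A ->
    lambda [set (g * h)%g | h in (A : set (dual R G))] = lambda A.

Definition class_M (G : zmodType)
    (mu : {finite_measure set (borel (dual R G)) -> \bar R}) : Prop :=
  regular mu /\ mu setT != 0%E.

End regular_haar.

Section best_approximation.
Context (R : realType) (G : zmodType).
Local Notation Gamma := (borel (dual R G)).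
Implicit Types (mu nu : {measure set Gamma -> \bar R}) (p : R) (S : set G).

Definition e_ (x : G) : Gamma -> R[i] := fun g => pairing g x.

Definition trig_poly S : set (Gamma -> R[i]) :=
  [set tau | exists (n : nat) (a : 'I_n -> R[i]) (x : 'I_n -> G),
     (forall j, S (x j)) /\ tau = fun g => \sum_(j < n) a j * e_ (x j) g].

Definition int_pow mu p (f : Gamma -> R[i]) : \bar R :=
  (\int[mu]_g (normc (1 - f g) `^ p)%:E)%E.

Definition d_ p mu S : \bar R :=
  ereal_inf [set int_pow mu p tau | tau in trig_poly S].

(* Elements of the complex space L^p(mu) are handled through representatives,
   so a member of the closure is only determined up to equality mu-a.e. *)
Definition complex_Lp mu p : set (Gamma -> R[i]) :=
  [set f | measurable_fun setT (f : Gamma -> borel R[i]^o) /\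
           finite_norm mu p%:E (fun g => normc (f g))].

Definition Lp_closure mu p (A : set (Gamma -> R[i])) : set (Gamma -> R[i]) :=
  [set f | complex_Lp mu p f /\
     forall eps : R, 0 < eps -> exists2 tau, A tau &
       ('N[mu]_(p%:E)[EFin \o (fun g => normc (f g - tau g)%R)] < eps%:E)%E].

Definition is_metric_proj mu p S (phi : Gamma -> R[i]) : Prop :=
  Lp_closure mu p (trig_poly S) phi /\ int_pow mu p phi = d_ p mu S.

(* A representative of the metric projection, which for 1 < p exists and is
   unique mu-a.e. *)
Definition metric_proj mu p S : Gamma -> R[i] :=
  xget (fun=> 0) (is_metric_proj mu p S).

(* For mu `<< nu this does not depend on the representative chosen above. *)
Definition d_cross p nu mu S : \bar R := int_pow mu p (metric_proj nu p S).

End best_approximation.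

(* Main.v *)
Require Import Defs.
From HB Require Import structures.
From mathcomp Require Import all_boot all_order all_algebra.
From mathcomp Require Import complex.
From mathcomp Require Import all_classical all_reals all_analysis.
From mathcomp Require Import measurable_realfun.
From mathcomp Require Import ring lra.

(** Let d nu = v d lambda and s = 1/(p-1). The theorem follows from an explicit
    description of the metric projection: if d_p(nu; S) > 0, then v > 0 almost
    everywhere, v^(-s) is integrable, and |1 - phi| = t for every metric
    projection phi, where t is v^(-s) divided by its integral.

    Two facts give this. First, 1 - tau has mean one for tau in T(S), because
    characters of non-zero frequency have mean zero. As t^(p-1) v is a constant
    k, the tangent-line inequality p t^(p-1) a <= a^p + (p-1) t^p, multiplied by v
    and integrated, shows that the integral of |f|^p v is at least k as soon as
    |f| has mean at least one, with equality only if |f| = t almost everywhere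
    (balanced_min, balanced_unique). This bounds the distance from below and
    gives uniqueness. Second, trigonometric polynomials are dense in
    L^1(lambda) and L^p(nu) simultaneously (trig_dense), so 1 - h is in the
    closure of T(S) for every non-negative h in L^p(nu) of mean one
    (mean_one_closure). Taking h = t shows that the lower bound k is attained;
    taking for h the normalised indicator of {v = 0} and the normalised
    truncations of v^(-s) shows that a positive distance forces v > 0 and
    v^(-s) integrable (projection_spec).

    To compare mu = w lambda with nu, let t be the function attached to nu. It
    has mean one, so it is a competitor in the minimisation attached to w:
    d_p(nu, mu; S), which is the integral of t^p w, is at least d_p(mu; S), and
    equality means that t is also the function attached to w. Then v and w are
    both proportional to t^(-(p-1)), hence to each other. Conversely, if
    nu = a mu then all the integrals for nu are a times those for mu. Finally,
    if d_p(nu; S) = 0, the projection is 1 nu-almost everywhere and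
    d_p(nu, mu; S) = 0.

    The mean of e_x vanishes by translation invariance when some character is
    not 1 at x. If instead all characters are 1 at some x <> 0, then 1 = e_x
    belongs to T(S) and all distances are 0. *)

Set Implicit Arguments.
Unset Strict Implicit.
Unset Printing Implicit Defensive.

Import Order.TTheory GRing.Theory Num.Theory.
Import numFieldNormedType.Exports.
Import ComplexField.Normc.
Local Open Scope classical_set_scope.
Local Open Scope ring_scope.

(** * A tangent-line inequality for powers *)

Section young.
Context (R : realType).
Implicit Types (p a t : R).

(** The graph of x^p lies strictly above its tangent at 1. Writing x = exp y,
    both x^(p-1) and x^-1 are exponentials and lie strictly above their own
    tangents 1 + (p-1) y and 1 - y; the combination of the two bounds that
    cancels y is the claim. *)
Lemma powR_tangent p x : 1 < p -> 0 < x ->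
  p * x <= x `^ p + (p - 1) ?= iff (x == 1).
Proof.
move=> p1 x0; have [->|x1] := eqVneq x 1.
  by rewrite powR1 mulr1; split; [lra|apply/eqP; lra].
pose y := ln x; have y0 : y != 0 by rewrite ln_eq0.
have xE : x = expR y by rewrite lnK// posrE.
have xpE : x `^ p = x * expR ((p - 1) * y).
  rewrite /powR gt_eqF// -/y [in RHS]xE -expRD; congr expR; lra.
have oneE : 1 = x * expR (- y).
  by rewrite [in RHS]xE -expRD subrr expR0.
suff lt : p * x < x `^ p + (p - 1) by split; [exact: ltW|rewrite lt_eqF].
have e1 : 1 + (p - 1) * y < expR ((p - 1) * y).
  by apply: expR_gt1Dx; rewrite mulf_neq0// subr_eq0 gt_eqF.
have e2 : 1 + - y < expR (- y) by apply: expR_gt1Dx; rewrite oppr_eq0.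
have h1 : x * (1 + (p - 1) * y) < x `^ p by rewrite xpE ltr_pM2l.
have h2 : x * (1 - y) < 1 by rewrite [ltRHS]oneE ltr_pM2l.
have h3 : (p - 1) * (x * (1 - y)) < (p - 1) * 1 by rewrite ltr_pM2l// subr_gt0.
lra.
Qed.

(** The tangent inequality at t instead of 1, by homogeneity. When t^(p-1) v is
    constant it compares the energy of a with a linear functional of a. *)
Lemma powR_young p a t : 1 < p -> 0 <= a -> 0 < t ->
  p * (t `^ (p - 1) * a) <= a `^ p + (p - 1) * t `^ p ?= iff (a == t).
Proof.
move=> p1 a0 t0; have tp0 : 0 < t `^ p by rewrite powR_gt0.
have p0 : p != 0 by rewrite gt_eqF// (lt_trans _ p1).
have [->|a_neq0] := eqVneq a 0.
  rewrite mulr0 powR0// add0r mulr0 (lt_eqF t0).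
  by split; rewrite ?(lt_eqF, ltW)// mulr_gt0// subr_gt0.
have x0 : 0 < a / t by rewrite divr_gt0// lt0r a_neq0.
have aE : a = t * (a / t) by rewrite mulrCA mulfV ?mulr1// gt_eqF.
have tE : t `^ p = t `^ (p - 1) * t.
  rewrite -{3}(powRr1 (ltW t0)) -powRD ?subrK//.
  by apply/implyP => _; rewrite gt_eqF.
have [le eq] := powR_tangent p1 x0.
have -> : (a == t) = (a / t == 1).
  apply/eqP/eqP => [->|at1]; first by rewrite divff// gt_eqF.
  by rewrite aE at1 mulr1.
move: x0 aE le eq; move: (a / t) => x x0 -> le eq.
rewrite powRM ?ltW//.
have -> : p * (t `^ (p - 1) * (t * x)) = t `^ p * (p * x) by rewrite tE; ring.
have -> : t `^ p * x `^ p + (p - 1) * t `^ p = t `^ p * (x `^ p + (p - 1)).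
  by ring.
split; first by rewrite ler_pM2l.
by rewrite (inj_eq (mulfI (lt0r_neq0 tp0))) eq.
Qed.

Lemma powR_normD (p a b : R) : 0 < p ->
  `|a + b| `^ p <= 2 `^ p * (`|a| `^ p + `|b| `^ p).
Proof.
move=> p0; wlog ba : a b / `|b| <= `|a|.
  move=> H; have [/H//|/ltW/H] := leP `|b| `|a|.
  by rewrite addrC [X in _ * X]addrC.
apply: (@le_trans _ _ (2 `^ p * `|a| `^ p)); last first.
  by rewrite ler_wpM2l ?powR_ge0// lerDl powR_ge0.
rewrite -powRM// ge0_ler_powR ?nnegrE ?mulr_ge0// ?(ltW p0)//.
by rewrite (le_trans (ler_normD _ _))// mulr_natl mulr2n lerD2l.
Qed.

End young.

(** * Functions of mean one and minimal weighted energy *)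

Section balanced.
Local Open Scope ereal_scope.
Context d (T : measurableType d) (R : realType).
Variable lam : {measure set T -> \bar R}.
Implicit Types (p k : R) (v t f : T -> R).

(** The Euler-Lagrange condition for minimising the integral of f^p v among
    non-negative f of mean one: the derivative t^(p-1) v is a constant
    multiplier k. Equivalently t is proportional to v^(-1/(p-1)). *)
Definition balanced p v t k := [/\ measurable_fun setT t,
  (forall x, 0 <= t x)%R, (0 < k)%R,
  {ae lam, forall x, (t x `^ (p - 1) * v x = k)%R} &
  \int[lam]_x (t x)%:E = 1].

Definition energy p v f := \int[lam]_x (f x `^ p * v x)%:E.

Lemma measurable_energy p v f : measurable_fun setT v ->
  measurable_fun setT f ->
  measurable_fun setT (fun x => (f x `^ p * v x)%:E).
Proof.
move=> mv mf; apply/measurable_EFinP/measurable_funM => //.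
exact: (measurableT_comp (measurable_powR p) mf).
Qed.

Lemma balancedP p v t k x : (1 < p)%R -> (0 <= t x)%R -> (0 <= v x)%R ->
  (0 < k)%R -> (t x `^ (p - 1) * v x = k)%R ->
  [/\ 0 < t x, 0 < v x & t x `^ p * v x = k * t x]%R.
Proof.
move=> p1 t0 v0 k0 tvk.
have tn0 : t x != 0%R.
  apply/eqP => t00; move: k0; rewrite -tvk t00 powR0 ?mul0r ?ltxx//.
  by rewrite subr_eq0 gt_eqF.
have vn0 : v x != 0%R.
  by apply/eqP => v00; move: k0; rewrite -tvk v00 mulr0 ltxx.
split; [by rewrite lt0r tn0|by rewrite lt0r vn0|].
rewrite -tvk -[in LHS](subrK 1%R p) [in LHS]powRD; last by rewrite tn0 implybT.
by rewrite powRr1//; ring.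
Qed.

Section bounds.
Variables (p : R) (v t : T -> R) (k : R).
Hypotheses (p1 : (1 < p)%R) (mv : measurable_fun setT v).
Hypotheses (v0 : (forall x, 0 <= v x)%R) (bal : balanced p v t k).

Let k0 : (0 < k)%R. Proof. by case: bal. Qed.
Let mt : measurable_fun setT t. Proof. by case: bal. Qed.
Let t0 x : (0 <= t x)%R. Proof. by case: bal. Qed.
Let intt : \int[lam]_x (t x)%:E = 1. Proof. by case: bal. Qed.
Let pm1 : (0 < p - 1)%R. Proof. by rewrite subr_gt0. Qed.
Let aetv : {ae lam, forall x, (t x `^ (p - 1) * v x = k)%R}.
Proof. by case: bal. Qed.

Lemma balanced_energy : energy p v t = k%:E.
Proof.
rewrite -[RHS]mule1 -intt -ge0_integralZl_EFin ?(ltW k0)//; last 2 first.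
- by move=> x _; rewrite lee_fin.
- exact/measurable_EFinP.
apply: ge0_ae_eq_integral => //.
- exact: measurable_energy.
- by apply/measurable_EFinP/measurable_funM.
- by move=> x _; rewrite lee_fin mulr_ge0// powR_ge0.
- by move=> x _; rewrite lee_fin mulr_ge0// ltW.
apply: filterS aetv => x tvk _.
by have [_ _ ->] := balancedP p1 (t0 x) (v0 x) k0 tvk.
Qed.

Let G f x := (f x `^ p * v x + (p - 1) * k * t x)%R.

Let G_young f : (forall x, 0 <= f x)%R ->
  {ae lam, forall x, (p * k * f x <= G f x ?= iff (f x == t x))%R}.
Proof.
move=> f0; apply: filterS aetv => x tvk.
have [tx vx tpv] := balancedP p1 (t0 x) (v0 x) k0 tvk.
have [le eq] := powR_young p1 (f0 x) tx.
have -> : G f x = ((f x `^ p + (p - 1) * t x `^ p) * v x)%R.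
  by rewrite mulrDl -(mulrA (p - 1)%R) tpv /G mulrA.
have -> : (p * k * f x = p * (t x `^ (p - 1) * f x) * v x)%R.
  by rewrite -tvk; ring.
split; first by rewrite ler_pM2r.
by rewrite (inj_eq (mulIf (lt0r_neq0 vx))) eq.
Qed.

Let mG f : measurable_fun setT f -> measurable_fun setT (G f).
Proof.
move=> mf; apply: measurable_funD; last exact: measurable_funM.
exact/measurable_EFinP/measurable_energy.
Qed.

Let G0 f x : (0 <= G f x)%R.
Proof. by rewrite addr_ge0 ?mulr_ge0 ?powR_ge0// ltW. Qed.

Let int_G f : measurable_fun setT f ->
  \int[lam]_x (G f x)%:E = energy p v f + ((p - 1) * k)%:E.
Proof.
move=> mf; under eq_integral do rewrite EFinD (EFinM ((p - 1) * k)).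
have pk0 : (0 <= (p - 1) * k)%R by rewrite mulr_ge0// ltW.
rewrite ge0_integralD//; last 4 first.
- by move=> x _; rewrite lee_fin mulr_ge0// powR_ge0.
- exact: measurable_energy.
- by move=> x _; rewrite -EFinM lee_fin mulr_ge0.
- by apply/measurable_EFinP/measurable_funM.
rewrite ge0_integralZl_EFin ?intt ?mule1//.
- by move=> x _; rewrite lee_fin.
- exact/measurable_EFinP.
Qed.

(** The tangent inequality at t, multiplied by v: the slope t^(p-1) v is the
    constant k, so the linear term integrates to the mean of f. Both sides may
    be infinite, which makes the bound usable before f is known to be
    integrable. *)
Lemma balanced_le_energy f : measurable_fun setT f ->
  (forall x, 0 <= f x)%R ->
  (p * k)%:E * \int[lam]_x (f x)%:E <= energy p v f + ((p - 1) * k)%:E.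
Proof.
move=> mf f0; have pk0 : (0 <= p * k)%R by rewrite mulr_ge0// ltW// (lt_trans _ p1).
rewrite -int_G// -ge0_integralZl_EFin//; last 2 first.
- by move=> x _; rewrite lee_fin.
- exact/measurable_EFinP.
apply: ae_ge0_le_integral => //.
- by move=> x _; rewrite -EFinM lee_fin mulr_ge0.
- by apply/measurable_EFinP/measurable_funM.
- by move=> x _; rewrite lee_fin.
- exact/measurable_EFinP/mG.
by apply: filterS (G_young f0) => x [? _] _; rewrite -EFinM lee_fin.
Qed.

Lemma balanced_min f : measurable_fun setT f -> (forall x, 0 <= f x)%R ->
  1 <= \int[lam]_x (f x)%:E -> k%:E <= energy p v f.
Proof.
move=> mf f0 f1; have p0 : (0 < p)%R by rewrite (lt_trans _ p1).
have := balanced_le_energy mf f0.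
move/(le_trans _); have pk1 : (p * k)%:E <= (p * k)%:E * \int[lam]_x (f x)%:E.
  by rewrite -[leLHS]mule1 lee_pmul2l// lte_fin mulr_gt0.
move=> /(_ _ pk1); rewrite -leeBlDr// -EFinB.
by have -> : (p * k - (p - 1) * k = k)%R by ring.
Qed.

(** Equality forces the tangent inequality to be an equality almost everywhere,
    because its two sides then have the same finite integral. *)
Lemma balanced_unique f : measurable_fun setT f -> (forall x, 0 <= f x)%R ->
  1 <= \int[lam]_x (f x)%:E -> energy p v f = k%:E ->
  {ae lam, forall x, f x = t x}.
Proof.
move=> mf f0 f1 fk; have p0 : (0 < p)%R by rewrite (lt_trans _ p1).
have pk0 : (0 < p * k)%R by rewrite mulr_gt0.
have intf : \int[lam]_x (f x)%:E = 1.
  apply/eqP; rewrite eq_le f1 andbT.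
  have := balanced_le_energy mf f0; rewrite fk -EFinD.
  have -> : (k + (p - 1) * k = p * k)%R by ring.
  by rewrite -[leRHS]mule1 lee_pmul2l.
have iG : lam.-integrable setT (EFin \o G f).
  apply/integrableP; split; first exact/measurable_EFinP/mG.
  under eq_integral do rewrite /= ger0_norm//.
  by rewrite int_G// fk -EFinD ltry.
have iF : lam.-integrable setT (EFin \o (fun x => p * k * f x)%R).
  apply/integrableP; split; first by apply/measurable_EFinP/measurable_funM.
  under eq_integral do rewrite /= ger0_norm ?mulr_ge0// ?ltW// EFinM.
  rewrite ge0_integralZl_EFin ?intf ?mule1 ?ltry ?ltW//.
  - by move=> x _; rewrite lee_fin.
  - exact/measurable_EFinP.
have mGF : measurable_fun setT (fun x => (G f x)%:E - (p * k * f x)%:E).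
  by apply: emeasurable_funB; [case/integrableP: iG|case/integrableP: iF].
have eq0 : \int[lam]_x `|(G f x)%:E - (p * k * f x)%:E| = 0.
  transitivity (\int[lam]_x ((G f x)%:E - (p * k * f x)%:E)).
    apply: ae_eq_integral => //; first exact: measurableT_comp.
    apply: filterS (G_young f0) => x [le _] _.
    by rewrite gee0_abs// -EFinB lee_fin subr_ge0.
  rewrite integralB_EFin// int_G// fk.
  under [X in _ - X]eq_integral do rewrite EFinM.
  rewrite ge0_integralZl_EFin ?intf ?mule1 ?ltry ?ltW//.
  - by rewrite -EFinD; congr EFin; ring.
  - by move=> x _; rewrite lee_fin.
  - exact/measurable_EFinP.
have /(ae_eq_integral_abs lam measurableT mGF) ae0 := eq0.
move: ae0; apply: filterS2 (G_young f0) => x [_ eq] /(_ I) GF.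
apply/eqP; rewrite -eq eq_sym -subr_eq0; apply/eqP.
exact: (EFin_inj GF).
Qed.

End bounds.
End balanced.

(** * Measurability of complex functions *)

Section complex_measurability.
Context (R : realType).
Local Notation C := R[i]%C.

Lemma ler_norm_Re (z : C) : `|complex.Re z| <= normc z.
Proof.
case: z => a b /=; rewrite -sqrtr_sqr ler_wsqrtr//.
by rewrite lerDl sqr_ge0.
Qed.

Lemma ler_norm_Im (z : C) : `|complex.Im z| <= normc z.
Proof.
case: z => a b /=; rewrite -sqrtr_sqr ler_wsqrtr//.
by rewrite lerDr sqr_ge0.
Qed.

Lemma normC_normc (z : C) : `|z| = (normc z)%:C%C.
Proof. by case: z. Qed.

Lemma normc_ge0 (z : C) : 0 <= normc z.
Proof. by case: z => a b; exact: sqrtr_ge0. Qed.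

Lemma nbhs_normc (z : C^o) (e : R) : 0 < e ->
  \forall y \near z, normc (z - y) < e.
Proof.
move=> e0; apply/nbhs_ballP; exists (e%:C)%C; first by rewrite /= ltcR.
by move=> y; rewrite -ball_normE /= normC_normc ltcR.
Qed.

Lemma Re_continuous : continuous (@complex.Re R : C^o -> R).
Proof.
move=> z; apply: (iffRL (@cvgrPdist_lt _ _ _ _ (nbhs_filter (z : C^o)) _ _)) => e e0.
apply: (@filterS _ _ (nbhs_filter (z : C^o)) _ _ _ (nbhs_normc z e0)) => y.
have -> : complex.Re z - complex.Re y = complex.Re (z - y).
  by case: z y => [? ?] [].
exact/le_lt_trans/ler_norm_Re.
Qed.

Lemma Im_continuous : continuous (@complex.Im R : C^o -> R).
Proof.
move=> z; apply: (iffRL (@cvgrPdist_lt _ _ _ _ (nbhs_filter (z : C^o)) _ _)) => e e0.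
apply: (@filterS _ _ (nbhs_filter (z : C^o)) _ _ _ (nbhs_normc z e0)) => y.
have -> : complex.Im z - complex.Im y = complex.Im (z - y).
  by case: z y => [? ?] [].
exact/le_lt_trans/ler_norm_Im.
Qed.

Lemma real_complex_continuous : continuous (fun r : R => r%:C%C : C^o).
Proof.
move=> r; apply/cvgrPdist_lt => e; rewrite ltcE /= => /andP[/eqP Ie Re0].
have := nbhsx_ballx r _ Re0; apply: filterS => y; rewrite -ball_normE /= => ry.
by rewrite -rmorphB /= normC_normc /= expr0n addr0 sqrtr_sqr ltcE /= -Ie eqxx.
Qed.

Lemma continuous_borel_measurable (X : ptopologicalType) (f : X -> R) :
  continuous f -> measurable_fun setT (f : borel X -> R).
Proof.
move=> /continuousP cf.
apply: (measurability _ (RGenOpens.measurableE R)).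
move=> _ [_ [a [b ->] <-]]; rewrite setTI.
by apply: sub_sigma_algebra; exact: cf (interval_open _ _).
Qed.

Context d (T : measurableType d).

Lemma measurable_real_complex (h : T -> R) : measurable_fun setT h ->
  measurable_fun setT ((fun x => (h x)%:C%C) : T -> borel C^o).
Proof.
move=> mh; apply: (@measurability _ _ _ (borel C^o) setT _ (@open C^o) erefl).
move=> _ [U oU <-].
rewrite (_ : _ @^-1` U = h @^-1` ((fun r : R => r%:C%C : C^o) @^-1` U))//.
apply: mh => //; apply: open_measurable.
by move/continuousP : real_complex_continuous; exact.
Qed.

Lemma measurable_Re (f : T -> C) : measurable_fun setT (f : T -> borel C^o) ->
  measurable_fun setT (fun x => complex.Re (f x)).
Proof.
move=> mf; apply: (@measurableT_comp _ _ _ _ _ _ (@complex.Re R : borel C^o -> R)) => //.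
exact: continuous_borel_measurable Re_continuous.
Qed.

Lemma measurable_Im (f : T -> C) : measurable_fun setT (f : T -> borel C^o) ->
  measurable_fun setT (fun x => complex.Im (f x)).
Proof.
move=> mf; apply: (@measurableT_comp _ _ _ _ _ _ (@complex.Im R : borel C^o -> R)) => //.
exact: continuous_borel_measurable Im_continuous.
Qed.

(** On real and imaginary parts, stability under the vector space operations and
    measurability of the modulus reduce to the case of real functions. *)
Definition cmeasurable (f : T -> C) :=
  measurable_fun setT (fun x => complex.Re (f x)) /\
  measurable_fun setT (fun x => complex.Im (f x)).

Lemma cmeasurable_normc f : cmeasurable f ->
  measurable_fun setT (fun x => normc (f x)).
Proof.
move=> [mr mi].
have -> : (fun x => normc (f x)) =
    (fun x => ((complex.Re (f x)) ^+ 2 + (complex.Im (f x)) ^+ 2) `^ 2^-1).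
  by apply/funext => x; rewrite powR12_sqrt ?addr_ge0 ?sqr_ge0//; case: (f x).
apply: (measurableT_comp (measurable_powR _)).
by apply: measurable_funD; exact: measurable_funX.
Qed.

Lemma cmeasurableD f g : cmeasurable f -> cmeasurable g ->
  cmeasurable (fun x => f x + g x).
Proof.
move=> [fr fi] [gr gi]; split.
  rewrite (_ : (fun x => _) =
    (fun x => complex.Re (f x)) \+ (fun x => complex.Re (g x))).
    exact: measurable_funD.
  by apply/funext => x /=; case: (f x); case: (g x).
rewrite (_ : (fun x => _) =
  (fun x => complex.Im (f x)) \+ (fun x => complex.Im (g x))).
  exact: measurable_funD.
by apply/funext => x /=; case: (f x); case: (g x).
Qed.

Lemma cmeasurableZ a f : cmeasurable f -> cmeasurable (fun x => a * f x).
Proof.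
move=> [fr fi]; split.
  rewrite (_ : (fun x => _) =
    (fun x => complex.Re a * complex.Re (f x)) \-
    (fun x => complex.Im a * complex.Im (f x))).
    by apply: measurable_funB; exact: measurable_funM.
  by apply/funext => x /=; case: a => ? ?; case: (f x).
rewrite (_ : (fun x => _) =
  (fun x => complex.Re a * complex.Im (f x)) \+
  (fun x => complex.Im a * complex.Re (f x))).
  by apply: measurable_funD; exact: measurable_funM.
by apply/funext => x /=; case: a => ? ?; case: (f x).
Qed.

Lemma cmeasurable_cst a : cmeasurable (fun=> a).
Proof. by split; exact: measurable_cst. Qed.

Lemma cmeasurableB f g : cmeasurable f -> cmeasurable g ->
  cmeasurable (fun x => f x - g x).
Proof.
move=> mf mg; apply: cmeasurableD => //.
rewrite (_ : (fun x => - g x) = (fun x => -1 * g x)); first exact: cmeasurableZ.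
by apply/funext => x; rewrite mulN1r.
Qed.

End complex_measurability.

(** * Trigonometric polynomials *)

Section trig_poly.
Context (R : realType) (G : zmodType).
Local Notation C := R[i]%C.
Local Notation Gamma := (borel (dual R G)).
Local Notation e_ := (@e_ R G).
Implicit Types (S : set G) (tau f : Gamma -> C) (g h : dual R G).

Lemma trig_poly0 S : trig_poly S (fun=> 0 : C).
Proof.
exists 0%N, (fun=> 0), (fun=> 0); split; first by case.
by apply/funext => g; rewrite big_ord0.
Qed.

Lemma trig_poly_cons S (a : C) x f : S x -> trig_poly S f ->
  trig_poly S (fun g => a * e_ x g + f g).
Proof.
move=> Sx [n [b [y [Sy ->]]]].
exists n.+1, (fun i => oapp b a (unlift ord0 i)).
exists (fun i => oapp y x (unlift ord0 i)); split.
  by move=> j; case: unliftP => [j0 _|_] /=; first exact: Sy.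
apply/funext => g; rewrite big_ord_recl unlift_none /=; congr (_ + _).
by apply: eq_bigr => i _; rewrite liftK.
Qed.

Lemma trig_poly_ind S (P : (Gamma -> C) -> Prop) : P (fun=> 0) ->
  (forall a x f, S x -> trig_poly S f -> P f ->
    P (fun g => a * e_ x g + f g)) ->
  forall tau, trig_poly S tau -> P tau.
Proof.
move=> P0 PS _ [n [a [x [Sx ->]]]]; elim: n => [|n IH] in a x Sx *.
  by under eq_fun do rewrite big_ord0.
under eq_fun do rewrite big_ord_recl; apply: PS => //; last exact: IH.
by exists n, (fun i => a (lift ord0 i)), (fun i => x (lift ord0 i)).
Qed.

Lemma trig_polyD S f f' : trig_poly S f -> trig_poly S f' ->
  trig_poly S (fun g => f g + f' g).
Proof.
move=> Sf Sf'; elim/trig_poly_ind : Sf => [|a x k Sx _ IH].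
  by under eq_fun do rewrite add0r.
under eq_fun do rewrite -addrA; exact: trig_poly_cons.
Qed.

Lemma trig_polyZ S a f : trig_poly S f -> trig_poly S (fun g => a * f g).
Proof.
elim/trig_poly_ind => [|b x k Sx _ IH].
  by under eq_fun do rewrite mulr0; exact: trig_poly0.
by under eq_fun do rewrite mulrDr mulrA; exact: trig_poly_cons.
Qed.

Lemma pairing0 g : pairing g 0 = 1.
Proof.
have g0 : pairing g 0 != 0 by rewrite -normr_gt0 pairing_norm.
by apply: (mulfI g0); rewrite -pairingD addr0 mulr1.
Qed.

Lemma pairingN g x : pairing g (- x) = (pairing g x)^*%C.
Proof.
have gx0 : pairing g x != 0 by rewrite -normr_gt0 pairing_norm.
apply: (mulfI gx0); rewrite -pairingD subrr pairing0 -sqr_normc.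
by rewrite pairing_norm expr1n.
Qed.

Lemma trig_poly_character x : trig_poly setT (e_ x).
Proof.
have := @trig_poly_cons setT 1 x _ I (trig_poly0 _).
by under eq_fun do rewrite mul1r addr0.
Qed.

Lemma trig_poly_cst a : trig_poly setT (fun _ : Gamma => a).
Proof.
have := @trig_poly_cons setT a 0 _ I (trig_poly0 setT).
by under eq_fun do rewrite /Defs.e_ pairing0 mulr1 addr0.
Qed.

Lemma trig_polyM f f' : trig_poly setT f -> trig_poly setT f' ->
  trig_poly setT (fun g => f g * f' g).
Proof.
move=> Tf Tf'; elim/trig_poly_ind : Tf => [|a x k _ _ IH].
  by under eq_fun do rewrite mul0r; exact: trig_poly0.
under eq_fun do rewrite mulrDl -mulrA.
apply: trig_polyD => //; apply: trig_polyZ; clear IH.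
elim/trig_poly_ind : Tf' => [|b y k' _ _ IH].
  by under eq_fun do rewrite mulr0; exact: trig_poly0.
under eq_fun do rewrite mulrDr mulrCA /Defs.e_ -pairingD.
exact: trig_poly_cons.
Qed.

Lemma trig_poly_split f : trig_poly setT f -> exists (c : C) tau,
  trig_poly [set x : G | x != 0] tau /\ f = fun g => c + tau g.
Proof.
elim/trig_poly_ind => [|a x k _ _ [c [tau [Ttau ->]]]].
  exists 0, (fun=> 0); split; first exact: trig_poly0.
  by under [in RHS]eq_fun do rewrite addr0.
have [->|x0] := eqVneq x 0.
  exists (a + c), tau; split=> //.
  by apply/funext => g; rewrite /Defs.e_ pairing0 mulr1 addrA.
exists c, (fun g => a * e_ x g + tau g); split; first exact: trig_poly_cons.
by apply/funext => g; rewrite addrCA.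
Qed.

Lemma trig_poly_bounded S f : trig_poly S f ->
  exists M : R, forall g, normc (f g) <= M.
Proof.
elim/trig_poly_ind => [|a x k _ _ [M kM]].
  by exists 0 => g; rewrite normc0.
exists (normc a + M) => g; rewrite (le_trans (le_normcD _ _))// lerD//.
rewrite normcM; have := pairing_norm g x.
by rewrite normC_normc => -[->]; rewrite mulr1.
Qed.

(** Real-valued trigonometric polynomials, with any frequencies: the algebra of
    functions that approximates bounded measurable ones. *)
Definition real_trig (f : dual R G -> R) : Prop :=
  trig_poly setT (fun g : Gamma => (f g)%:C%C).

Lemma real_trig_cst a : real_trig (fun=> a).
Proof. exact: trig_poly_cst. Qed.

Lemma real_trigD (f f' : dual R G -> R) : real_trig f -> real_trig f' ->
  real_trig (fun g => f g + f' g).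
Proof.
by move=> ? ?; rewrite /real_trig; under eq_fun do rewrite rmorphD; exact: trig_polyD.
Qed.

Lemma real_trigM (f f' : dual R G -> R) : real_trig f -> real_trig f' ->
  real_trig (fun g => f g * f' g).
Proof.
by move=> ? ?; rewrite /real_trig; under eq_fun do rewrite rmorphM; exact: trig_polyM.
Qed.

Lemma real_trigX (f : dual R G -> R) n : real_trig f -> real_trig (fun g => f g ^+ n).
Proof.
move=> Tf; elim: n => [|n IH]; first exact: real_trig_cst.
by under eq_fun do rewrite exprS; exact: real_trigM.
Qed.

(** As characters have modulus 1, |g x - h x|^2 is 2 minus two characters of
    frequencies x and - x in h. *)
Lemma real_trig_dist g x :
  real_trig (fun h => normc (pairing g x - pairing h x) ^+ 2).
Proof.
rewrite /real_trig (_ : (fun h => _) = fun h : Gamma =>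
  - pairing g x * e_ (- x) h + ((- (pairing g x)^*%C) * e_ x h + 2)).
  by do 2! apply: trig_poly_cons => //; exact: trig_poly_cst.
apply/funext => h; set z := _ - _.
rewrite (_ : _%:C%C = `|z| ^+ 2); last by rewrite normC_normc -rmorphXn.
rewrite sqr_normc /Defs.e_ pairingN /z.
have gg := sqr_normc (pairing g x); have hh := sqr_normc (pairing h x).
rewrite pairing_norm expr1n in gg; rewrite pairing_norm expr1n in hh.
rewrite rmorphB /= mulrBl !mulrBr -gg -hh; ring.
Qed.

End trig_poly.

(** * Topology of the dual group *)

Section dual_topology.
Context (R : realType) (G : zmodType).
Local Notation C := R[i]%C.
Local Notation Gamma := (borel (dual R G)).
Local Notation e_ := (@e_ R G).
Implicit Types (g h : dual R G).

Lemma pairing_continuous x : continuous ((fun g => pairing g x) : dual R G -> C^o).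
Proof.
move=> g.
apply: (@continuous_comp (dual R G) {ptws G -> C^o} C^o set_val
  (fun f : {ptws G -> C^o} => f x)).
  exact: initial_continuous.
exact: (@proj_continuous G (fun=> C^o) x).
Qed.

Lemma dual_cvg (F : set_system (dual R G)) g : Filter F ->
  (forall x, (fun h => pairing h x : C^o) @ F --> (pairing g x : C^o)) ->
  F --> g.
Proof.
move=> FF Fg A [_ [[B oB <-] Bg] BA].
have /(_ B) : {ptws, (set_val : dual R G -> {ptws G -> C^o}) @ F --> set_val g}.
  apply/cvg_sup => x.
  have surj : (fun f : {ptws G -> C^o} => f x) @` setT = setT.
    by rewrite eqEsubset; split => z //; exists (fun=> z).
  apply/(@cvg_image _ _ (fun f : {ptws G -> C^o} => f x) _ _ _ surj).
  move=> N /(Fg x) FN; exists ((fun f : {ptws G -> C^o} => f x) @^-1` N) => //.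
  by rewrite image_preimage.
by move=> /(_ (open_nbhs_nbhs (conj oB Bg))) FB; exact: (filterS BA FB).
Qed.

Lemma dual_hausdorff : hausdorff_space (dual R G).
Proof.
move=> g h gh; apply: pairing_inj => x.
have key (f : C^o -> R) : continuous f -> f (pairing g x) = f (pairing h x).
  move=> cf; apply: (@Rhausdorff R) => A B nA nB.
  have c y : {for y, continuous (fun y : dual R G => f (pairing y x))}.
    by apply: continuous_comp; [exact: pairing_continuous|exact: cf].
  have [z [zA zB]] := gh _ _ (c g _ nA) (c h _ nB).
  by exists (f (pairing z x)).
have := key _ (@Re_continuous R); have := key _ (@Im_continuous R).
by case: (pairing g x) => ? ?; case: (pairing h x) => ? ? /= -> ->.
Qed.

Lemma compact_borel (K : set (dual R G)) : compact K -> measurable (K : set Gamma).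
Proof.
move=> cK; have := compact_closed dual_hausdorff cK.
move=> /closed_openC oK; rewrite -(setCK (K : set Gamma)); apply: measurableC.
exact: sub_sigma_algebra.
Qed.

Lemma open_borel (U : set (dual R G)) : open U -> measurable (U : set Gamma).
Proof. exact: sub_sigma_algebra. Qed.

Lemma continuous_comb (T : topologicalType) (u v w : T -> R) (a b : R) :
  continuous u -> continuous v -> continuous w ->
  continuous (fun x => a * u x + b * v x + w x).
Proof.
move=> cu cv cw x.
exact: (cvgD (cvgD (cvgM (cvg_cst a) (cu x)) (cvgM (cvg_cst b) (cv x))) (cw x)).
Qed.

Lemma trig_poly_continuous (S : set G) (f : Gamma -> C) : trig_poly S f ->
  continuous (fun g : dual R G => complex.Re (f g)) /\
  continuous (fun g : dual R G => complex.Im (f g)).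
Proof.
elim/trig_poly_ind => [|a x k _ _ [cr ci]]; first by split; exact: cst_continuous.
have cer : continuous (fun g : dual R G => complex.Re (e_ x g)).
  by move=> g; apply: continuous_comp; [exact: pairing_continuous|exact: Re_continuous].
have cei : continuous (fun g : dual R G => complex.Im (e_ x g)).
  by move=> g; apply: continuous_comp; [exact: pairing_continuous|exact: Im_continuous].
split.
  rewrite (_ : (fun g => _) = fun g : dual R G =>
    complex.Re a * complex.Re (e_ x g) + (- complex.Im a) * complex.Im (e_ x g) +
    complex.Re (k g)).
    exact: continuous_comb.
  by apply/funext => g; rewrite mulNr; case: a; case: (e_ x g); case: (k g).
rewrite (_ : (fun g => _) = fun g : dual R G =>
  complex.Re a * complex.Im (e_ x g) + complex.Im a * complex.Re (e_ x g) +
  complex.Im (k g)).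
  exact: continuous_comb.
by apply/funext => g; case: a; case: (e_ x g); case: (k g).
Qed.

Lemma trig_poly_cmeasurable (S : set G) (f : Gamma -> C) : trig_poly S f ->
  cmeasurable f.
Proof.
by move=> /trig_poly_continuous[cr ci]; split; exact: continuous_borel_measurable.
Qed.

Lemma real_trig_continuous (f : dual R G -> R) : real_trig f -> continuous f.
Proof. by move=> /trig_poly_continuous[]. Qed.

Lemma real_trig_measurable (f : dual R G -> R) : real_trig f ->
  measurable_fun setT (f : Gamma -> R).
Proof. by move=> /real_trig_continuous; exact: continuous_borel_measurable. Qed.

Lemma real_trig_bounded (f : dual R G -> R) : real_trig f ->
  exists M, forall g, `|f g| <= M.
Proof.
move=> /trig_poly_bounded[M fM]; exists M => g; have := fM g.
by rewrite /= expr0n addr0 sqrtr_sqr.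
Qed.

(** The sublevel sets of these D form a filter at g, and it converges to g
    because the squared distances |g x - h x|^2 are among the D: convergence in
    the dual is convergence at each x. Hence every neighbourhood of g contains
    one of them. *)
Lemma nbhs_real_trig g (U : set (dual R G)) : nbhs g U ->
  exists D, [/\ real_trig D, (forall h, 0 <= D h), D g = 0 &
    exists2 e : R, 0 < e & forall h, D h < e -> U h].
Proof.
pose F : set_system (dual R G) := fun A => exists D : dual R G -> R,
  [/\ real_trig D, (forall h, 0 <= D h), D g = 0 &
    exists2 e : R, 0 < e & forall h, D h < e -> A h].
have FF : Filter F.
  split.
  - exists (fun=> 0); split => //; first exact: real_trig_cst.
    by exists 1.
  - move=> A B [D [TD D0 Dg [e e0 DA]]] [D' [TD' D'0 D'g [e' e'0 DB]]].
    exists (fun h => D h + D' h); split => //.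
    + exact: real_trigD.
    + by move=> h; rewrite addr_ge0.
    + by rewrite Dg D'g addr0.
    exists (Num.min e e'); first by rewrite lt_min e0.
    move=> h; rewrite lt_min => /andP[h1 h2]; split.
      by apply: DA; rewrite (le_lt_trans _ h1)// lerDl.
    by apply: DB; rewrite (le_lt_trans _ h2)// lerDr.
  - move=> A B AB [D [TD D0 Dg [e e0 DA]]]; exists D; split => //.
    by exists e => // h /DA/AB.
suff : F --> g by apply.
apply: dual_cvg => x A /= [e e0 eA].
rewrite /= in e0; move: e0 eA; rewrite ltcE /= => /andP[/eqP Ie e0] eA.
exists (fun h => normc (pairing g x - pairing h x) ^+ 2); split => //.
- exact: real_trig_dist.
- by move=> h; rewrite sqr_ge0.
- by rewrite subrr normc0 expr0n.
exists (complex.Re e ^+ 2); first by rewrite exprn_gt0.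
move=> h hh; apply: eA; rewrite /= normC_normc ltcE /= -Ie eqxx /=.
by rewrite -(ltr_pXn2r (_ : 0 < 2)%N)// nnegrE ?normc_ge0// ltW.
Qed.

End dual_topology.

(** * Trigonometric polynomials without constant term have mean zero *)

Lemma bounded_measurable_integrable d (T : measurableType d) (R : realType)
    (m : {measure set T -> \bar R}) (f : T -> R) (M : R) :
  (m setT < +oo)%E -> measurable_fun setT f -> (forall x, `|f x| <= M) ->
  m.-integrable setT (EFin \o f).
Proof.
move=> mT mf fM; apply: measurable_bounded_integrable => //.
exists M; split; first exact: num_real.
by move=> N MN x _; exact: le_trans (fM x) (ltW MN).
Qed.

Section haar_mean.
Context (R : realType) (G : zmodType).
Local Notation C := R[i]%C.
Local Notation Gamma := (borel (dual R G)).
Local Notation e_ := (@e_ R G).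
Implicit Types (g h : dual R G).

Lemma trig_poly_integrable (m : {measure set Gamma -> \bar R}) (S : set G)
    (f : Gamma -> C) : (m setT < +oo)%E -> trig_poly S f ->
  m.-integrable setT (EFin \o (fun g => complex.Re (f g))) /\
  m.-integrable setT (EFin \o (fun g => complex.Im (f g))).
Proof.
move=> mT Sf; have [M fM] := trig_poly_bounded Sf.
have [mr mi] := trig_poly_cmeasurable Sf.
split; apply: (@bounded_measurable_integrable _ _ _ _ _ M) => // g.
  exact: le_trans (ler_norm_Re _) (fM g).
exact: le_trans (ler_norm_Im _) (fM g).
Qed.

Lemma dual_mul_continuous g : continuous (fun h => (g * h)%g : dual R G).
Proof.
move=> h; apply: dual_cvg => [|x]; first exact: (@fmap_filter _ _ _ _ (nbhs_filter h)).
exact: (cvgM (cvg_cst (pairing g x : C^o)) (@pairing_continuous R G x h)).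
Qed.

Lemma dual_mul_measurable g :
  measurable_fun setT ((fun h => (g * h)%g : dual R G) : Gamma -> Gamma).
Proof.
apply: (@measurability _ _ Gamma Gamma setT _ (@open (dual R G)) erefl).
move=> _ [U oU <-]; rewrite setTI; apply: sub_sigma_algebra.
by move/continuousP : (@dual_mul_continuous g); exact.
Qed.

Variable lambda : probability Gamma R.
Hypothesis haar : is_haar lambda.

Let iZ c (u : Gamma -> R) : lambda.-integrable setT (EFin \o u) ->
  lambda.-integrable setT (EFin \o (fun h => c * u h)).
Proof. by move=> iu; have := integrableZl measurableT c iu. Qed.

Let iD (u v : Gamma -> R) : lambda.-integrable setT (EFin \o u) ->
  lambda.-integrable setT (EFin \o v) ->
  lambda.-integrable setT (EFin \o (fun h => u h + v h)).
Proof. by move=> iu iv; have := integrableD measurableT iu iv. Qed.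

Lemma haar_translate g (f : Gamma -> R) : measurable_fun setT f ->
  lambda.-integrable setT (EFin \o (fun h : Gamma => f (g * h)%g)) ->
  (\int[lambda]_h f (g * h)%g = \int[lambda]_h f h)%R.
Proof.
move=> mf intf; congr fine.
have mphi := dual_mul_measurable g.
transitivity (\int[pushforward lambda
    ((fun h => (g * h)%g : dual R G) : Gamma -> Gamma)]_h (f h)%:E)%E.
  by rewrite (integral_pushforward mphi (f := EFin \o f))//; exact/measurable_EFinP.
apply: eq_measure_integral => A mA _; rewrite /pushforward /=.
have [_ inv] := haar; rewrite -(inv (g^-1)%g A mA); congr (lambda _).
rewrite eqEsubset; split => h /=.
  by move=> Ah; exists (g * h)%g => //; rewrite mulKg.
by move=> [h' Ah' <-]; rewrite mulVKg.
Qed.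

(** Translation by g multiplies e_x by the number a + i b = e_x(g), so the
    vector (A, B) of integrals of the real and imaginary parts is fixed by the
    rotation of matrix (a, -b; b, a). A rotation other than the identity fixes
    only 0. *)
Lemma haar_character g x : pairing g x != 1 ->
  (\int[lambda]_h complex.Re (e_ x h) = 0)%R /\
  (\int[lambda]_h complex.Im (e_ x h) = 0)%R.
Proof.
move=> gx1.
have Se := @trig_poly_character R G x.
have lT : (lambda setT < +oo)%E by rewrite probability_setT ltry.
have [ir ii] := trig_poly_integrable lT Se.
have [mr mi] := trig_poly_cmeasurable Se.
set A := Rintegral _ _ _; set B := Rintegral _ _ _.
case gE : (pairing g x) => [a b].
have ReE h : complex.Re (e_ x (g * h)%g) =
    a * complex.Re (e_ x h) - b * complex.Im (e_ x h).
  rewrite /Defs.e_ [pairing _ _](_ : _ = pairing g x * pairing h x)// gE.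
  by case: (pairing h x).
have ImE h : complex.Im (e_ x (g * h)%g) =
    a * complex.Im (e_ x h) + b * complex.Re (e_ x h).
  rewrite /Defs.e_ [pairing _ _](_ : _ = pairing g x * pairing h x)// gE.
  by case: (pairing h x).
have eA : A = a * A - b * B.
  rewrite {1}/A -(haar_translate (g := g))//.
    under eq_Rintegral do rewrite ReE.
    by rewrite RintegralB// ?RintegralZl//; exact: iZ.
  rewrite (_ : _ \o _ = (fun h =>
      (a * complex.Re (e_ x h))%:E - (b * complex.Im (e_ x h))%:E)%E).
    by apply: (integrableB measurableT); exact: iZ.
  by apply/funext => h /=; rewrite ReE.
have eB : B = a * B + b * A.
  rewrite {1}/B -(haar_translate (g := g))//.
    under eq_Rintegral do rewrite ImE.
    by rewrite RintegralD// ?RintegralZl//; exact: iZ.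
  rewrite (_ : _ \o _ = (fun h =>
      (a * complex.Im (e_ x h))%:E + (b * complex.Re (e_ x h))%:E)%E).
    by apply: (integrableD measurableT); exact: iZ.
  by apply/funext => h /=; rewrite ImE.
have ab : (1 - a) ^+ 2 + b ^+ 2 != 0.
  rewrite paddr_eq0 ?sqr_ge0// !sqrf_eq0; apply: contra gx1 => /andP[a1 /eqP b0].
  by move: a1; rewrite subr_eq0 gE b0 => /eqP <-.
have e1 : ((1 - a) ^+ 2 + b ^+ 2) * A = 0.
  have : (1 - a) * (A - (a * A - b * B)) - b * (B - (a * B + b * A)) = 0.
    by rewrite -eA -eB !subrr !mulr0 subrr.
  by move=> <-; ring.
have e2 : ((1 - a) ^+ 2 + b ^+ 2) * B = 0.
  have : (1 - a) * (B - (a * B + b * A)) + b * (A - (a * A - b * B)) = 0.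
    by rewrite -eA -eB !subrr !mulr0 addr0.
  by move=> <-; ring.
by split; apply/eqP; [move/eqP: e1|move/eqP: e2]; rewrite mulf_eq0 (negbTE ab).
Qed.

Lemma haar_trig_poly (S : set G) (f : Gamma -> C) :
  (forall x, S x -> exists g, pairing g x != 1) -> trig_poly S f ->
  (\int[lambda]_h complex.Re (f h) = 0)%R /\
  (\int[lambda]_h complex.Im (f h) = 0)%R.
Proof.
move=> sep; elim/trig_poly_ind => [|a x k Sx Sk [k1 k2]].
  by rewrite !Rintegral_cst// !mul0r.
have [g /haar_character[e1 e2]] := sep x Sx.
have Se := @trig_poly_character R G x.
have lT : (lambda setT < +oo)%E by rewrite probability_setT ltry.
have [ir ii] := trig_poly_integrable lT Se.
have [kr ki] := trig_poly_integrable lT Sk.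
split.
  under eq_Rintegral => h _.
    rewrite (_ : complex.Re _ = complex.Re a * complex.Re (e_ x h) +
      (- complex.Im a) * complex.Im (e_ x h) + complex.Re (k h)); last first.
      by rewrite mulNr; case: a; case: (e_ x h); case: (k h).
    over.
  rewrite RintegralD//; last by apply: iD; exact: iZ.
  rewrite RintegralD// ?RintegralZl ?e1 ?e2 ?k1 ?mulr0 ?addr0//; exact: iZ.
under eq_Rintegral => h _.
  rewrite (_ : complex.Im _ = complex.Re a * complex.Im (e_ x h) +
    complex.Im a * complex.Re (e_ x h) + complex.Im (k h)); last first.
    by case: a; case: (e_ x h); case: (k h).
  over.
rewrite RintegralD//; last by apply: iD; exact: iZ.
by rewrite RintegralD// ?RintegralZl ?e1 ?e2 ?k2 ?mulr0 ?addr0//; exact: iZ.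
Qed.

End haar_mean.

(** * Separation of compact sets by trigonometric polynomials *)

Section urysohn.
Context (R : realType) (G : zmodType).
Local Notation Gamma := (borel (dual R G)).
Implicit Types (g h : dual R G) (U V : set (dual R G)).

Lemma bernoulli_sub (x : R) n : 0 <= x <= 1 -> 1 - n%:R * x <= (1 - x) ^+ n.
Proof.
move=> /andP[x0 x1]; elim: n => [|n IH]; first by rewrite mul0r subr0 expr0.
rewrite exprS; have y0 : 0 <= 1 - x by rewrite subr_ge0.
apply: le_trans (ler_wpM2l y0 IH).
rewrite -natr1; have : 0 <= n%:R * x * x by rewrite !mulr_ge0.
lra.
Qed.

(** (1 - x)^n (1 + x)^n <= 1, and (1 + x)^n >= n x. *)
Lemma bernoulli_inv (x : R) n : 0 <= x <= 1 -> n%:R * x * (1 - x) ^+ n <= 1.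
Proof.
move=> /andP[x0 x1]; have y0 : 0 <= 1 - x by rewrite subr_ge0.
have le1 : n%:R * x <= (1 + x) ^+ n.
  elim: n => [|n IH]; first by rewrite mul0r.
  rewrite exprS mulrDl mul1r -natr1 mulrDl mul1r lerD// ler_peMr//.
  by rewrite exprn_ege1// lerDl.
apply: (le_trans (ler_wpM2r (exprn_ge0 n y0) le1)).
rewrite -exprMn exprn_ile1//; first by rewrite mulr_ge0// addr_ge0.
by have := sqr_ge0 x; lra.
Qed.

Definition trig_separated U V := forall e : R, 0 < e -> exists q : dual R G -> R,
  [/\ real_trig q, forall h, 0 <= q h <= 1,
    forall h, V h -> 1 - e <= q h & forall h, ~ U h -> q h <= e].

Lemma trig_separated0 U : trig_separated U set0.
Proof.
move=> e e0; exists (fun=> 0); split=> [||//|_ _]; last exact: ltW.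
  exact: real_trig_cst.
by move=> h; rewrite lexx ler01.
Qed.

(** The witness 1 - (1 - q)(1 - q') is near 1 where q or q' is, and near 0 where
    both are. *)
Lemma trig_separatedU U V V' : trig_separated U V -> trig_separated U V' ->
  trig_separated U (V `|` V').
Proof.
move=> UV UV' e e0; have e20 : 0 < e / 2 by rewrite divr_gt0.
have [q [Tq q01 qV qU]] := UV _ e20.
have [q' [Tq' q'01 q'V q'U]] := UV' _ e20.
exists (fun h => q h + q' h + (-1) * (q h * q' h)); split.
- apply: real_trigD; first exact: real_trigD.
  by apply: real_trigM; [exact: real_trig_cst|exact: real_trigM].
- by move=> h; have := q01 h; have := q'01 h; nra.
- move=> h [/qV|/q'V]; have := q01 h; have := q'01 h; nra.
- by move=> h Uh; have := qU h Uh; have := q'U h Uh; have := q01 h; have := q'01 h; nra.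
Qed.

(** The construction of Brosowski and Deutsch: take D in [0, 1] vanishing at g
    and bounded below off U, and k with k D >= 2 off U. By Bernoulli's
    inequality q_n = (1 - D^n)^(k^n) is at least 1 - (k D)^n and at most
    (k D)^(-n), so it tends to 1 uniformly where k D < 1/2 and to 0 uniformly
    off U. *)
Lemma trig_separated_point U g : open U -> U g ->
  exists2 V, open V /\ V g & trig_separated U V.
Proof.
move=> oU Ug.
have [D [TD D0 Dg [e e0 DU]]] := nbhs_real_trig (open_nbhs_nbhs (conj oU Ug)).
have [M DM] := real_trig_bounded TD.
have M0 : 0 <= M by apply: le_trans (DM g).
(* D rescaled to take values in [0, 1]; k is large enough that k D' >= 2 off U *)
pose c := (M + 1)^-1; have c0 : 0 < c by rewrite invr_gt0 ltr_wpDl.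
pose D' h := c * D h.
have D'01 h : 0 <= D' h <= 1.
  rewrite mulr_ge0 ?(ltW c0)//= /D' mulrC ler_pdivrMr ?ltr_wpDl// mul1r.
  by rewrite (le_trans (ler_norm _))// (le_trans (DM h))// lerDl.
pose k := (Num.truncn (2 / (c * e))).+1.
have kce : 2 <= k%:R * (c * e).
  by rewrite -ler_pdivrMr ?mulr_gt0// ltW// truncnS_gt.
have k0 : 0 < k%:R :> R by rewrite ltr0n.
exists [set h | k%:R * D' h < 1 / 2].
  split.
    have cD : continuous (fun h => k%:R * D' h).
      apply: real_trig_continuous; apply: real_trigM; first exact: real_trig_cst.
      by apply: real_trigM => //; exact: real_trig_cst.
    rewrite (_ : [set h | _] = (fun h => k%:R * D' h) @^-1` [set x | x < 1 / 2])//.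
    by move/continuousP : cD; apply; exact: open_lt.
  by rewrite /= /D' Dg !mulr0 divr_gt0.
move=> eps eps0.
have [n neps] : exists n, (1 / 2) ^+ n < eps :> R.
  have : `|1 / 2| < 1 :> R by rewrite ger0_norm//; lra.
  move=> /cvg_expr /cvgrPdist_lt /(_ _ eps0) [n _ /(_ n (leqnn n))] /=.
  rewrite sub0r normrN ger0_norm; first by exists n.
  by rewrite exprn_ge0.
have X01 h : 0 <= D' h ^+ n <= 1.
  have /andP[? ?] := D'01 h; by rewrite exprn_ge0// exprn_ile1.
exists (fun h => (1 + (-1) * D' h ^+ n) ^+ (k ^ n)%N); split.
- apply: real_trigX; apply: real_trigD; first exact: real_trig_cst.
  apply: real_trigM; first exact: real_trig_cst.
  by apply: real_trigX; apply: real_trigM => //; exact: real_trig_cst.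
- move=> h; have /andP[? ?] := X01 h; rewrite mulN1r.
  by rewrite exprn_ge0 ?subr_ge0// exprn_ile1 ?subr_ge0// gerBl.
- move=> h /= hV; rewrite mulN1r; apply: le_trans (bernoulli_sub _ (X01 h)).
  rewrite lerD2l lerN2 (le_trans _ (ltW neps))// natrX -exprMn lerXn2r ?nnegrE//.
    by rewrite mulr_ge0//; case/andP: (D'01 h).
  exact: ltW.
- move=> h hU; rewrite mulN1r.
  have eD : e <= D h by rewrite leNgt; apply/negP => /DU.
  have kD : 2 <= k%:R * D' h.
    by rewrite (le_trans kce)// ler_wpM2l// ler_wpM2l// ltW.
  have := bernoulli_inv (k ^ n) (X01 h); rewrite natrX -exprMn.
  set q := _ ^+ (k ^ n); rewrite -/q => qle.
  have q0 : 0 <= q by rewrite exprn_ge0// subr_ge0; case/andP: (X01 h).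
  rewrite (le_trans _ (ltW neps))// expr_div_n expr1n ler_pdivlMr ?exprn_gt0//.
  rewrite mulrC (le_trans _ qle)// ler_wpM2r// lerXn2r ?nnegrE//.
  exact: le_trans kD.
Qed.

Lemma trig_urysohn (K U : set (dual R G)) : compact K -> open U -> K `<=` U ->
  trig_separated U K.
Proof.
move=> cK oU KU.
have /choice[V VP] : forall g : dual R G, exists V, open V /\
    (U g -> V g /\ trig_separated U V).
  move=> g; have [Ug|nUg] := pselect (U g).
    by have [V [oV Vg] UV] := trig_separated_point oU Ug; exists V.
  by exists set0; split; first exact: open0.
rewrite compact_cover in cK.
have [||D' D'K KD'] := cK _ K V.
- by move=> g _; case: (VP g).
- by move=> g Kg; exists g => //; case: (VP g) => _ /(_ (KU _ Kg)) [].
have sepD (s : seq (dual R G)) : {in s, forall g, K g} ->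
    trig_separated U [set h | exists2 g, g \in s & V g h].
  elim: s => [|g s IH] Ks.
    rewrite (_ : [set h | _] = set0); first exact: trig_separated0.
    by rewrite -subset0 => h [].
  rewrite (_ : [set h | _] = V g `|` [set h | exists2 g, g \in s & V g h]).
    apply: trig_separatedU; last first.
      by apply: IH => g' g's; apply: Ks; rewrite inE g's orbT.
    by have [_ /(_ (KU _ (Ks g (mem_head _ _)))) []] := VP g.
  rewrite eqEsubset; split => h /=.
    move=> [g']; rewrite inE => /orP[/eqP-> ?|? ?]; first by left.
    by right; exists g'.
  move=> [Vgh|[g' g's Vg'h]]; first by exists g => //; exact: mem_head.
  by exists g' => //; rewrite inE g's orbT.
move=> e e0; have [|q [Tq q01 qV qU]] := sepD (finmap.enum_fset D') _ e e0.
  by move=> g /D'K /set_mem.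
exists q; split => // h /KD' [g gD' Vgh]; apply: qV.
by exists g.
Qed.

End urysohn.

(** * Density of trigonometric polynomials *)

Section density.
Context (R : realType) (G : zmodType).
Local Notation Gamma := (borel (dual R G)).
Implicit Types (m : {measure set Gamma -> \bar R}).
Local Open Scope ereal_scope.

(** Unlike the two halves of regularity taken separately, this form passes to the
    sum of two finite measures by intersecting the open sets and uniting the
    compact ones. *)
Definition sandwiched m := forall (A : set Gamma) (e : R),
  measurable A -> (0 < e)%R -> exists K U : set (dual R G),
  [/\ compact K, open U, K `<=` A, A `<=` U & m (U `\` K : set Gamma) < e%:E].

Lemma regular_sandwiched m : m setT < +oo -> regular m -> sandwiched m.
Proof.
move=> mT reg A e mA e0; have e20 : (0 < e / 2)%R by rewrite divr_gt0.
have fin (B : set Gamma) : measurable B -> m B \is a fin_num.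
  move=> mB; rewrite ge0_fin_numE// (le_lt_trans _ mT)// le_measure ?inE//.
have [infA supA] := reg A mA.
have [|_ [U [oU AU] <-] Ue] := lb_ereal_inf_adherent e20 (_ : ereal_inf
    [set m U | U in [set U : set (dual R G) | open U /\ A `<=` U]] \is a fin_num).
  by rewrite -infA fin.
have [|_ [K [cK KA] <-] Ke] := ub_ereal_sup_adherent e20 (_ : ereal_sup
    [set m K | K in [set K : set (dual R G) | compact K /\ K `<=` A]] \is a fin_num).
  by rewrite -supA fin.
rewrite -infA in Ue; rewrite -supA in Ke.
exists K, U; split => //.
have mU := open_borel oU; have mK := compact_borel cK.
rewrite measureD//; last by rewrite ltey_eq fin.
rewrite setIidr; last exact: subset_trans AU.
have key (x y z : \bar R) : x \is a fin_num -> y \is a fin_num ->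
    z \is a fin_num -> y < x + (e / 2)%:E -> x - (e / 2)%:E < z -> y - z < e%:E.
  move: x y z => [x| |] [y| |] [z| |] // _ _ _.
  by rewrite -!EFinD !lte_fin => *; lra.
exact: key (fin _ mA) (fin _ mU) (fin _ mK) Ue Ke.
Qed.

(** An approximation in the mean for m1 + m2 is one for m1 and for m2; this is how
    a single polynomial serves both measures in trig_dense. *)
Lemma sandwiched_add m1 m2 : sandwiched m1 -> sandwiched m2 ->
  sandwiched (measure_add m1 m2).
Proof.
move=> s1 s2 A e mA e0; have e20 : (0 < e / 2)%R by rewrite divr_gt0.
have [K1 [U1 [cK1 oU1 KA1 AU1 me1]]] := s1 A _ mA e20.
have [K2 [U2 [cK2 oU2 KA2 AU2 me2]]] := s2 A _ mA e20.
exists (K1 `|` K2), (U1 `&` U2); split.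
- exact: compactU.
- exact: openI.
- by rewrite subUset.
- by rewrite subsetI.
have mm (K U : set (dual R G)) : compact K -> open U ->
    measurable (U `\` K : set Gamma).
  by move=> cK oU; apply: measurableD; [exact: open_borel|exact: compact_borel].
rewrite [ltLHS](measure_addE m1 m2) (splitr e) EFinD lteD//.
  apply: le_lt_trans me1; apply: le_measure; rewrite ?inE.
  - by apply: mm; [exact: compactU|exact: openI].
  - exact: mm.
  - by move=> x [[? _] nK]; split => // ?; apply: nK; left.
apply: le_lt_trans me2; apply: le_measure; rewrite ?inE.
- by apply: mm; [exact: compactU|exact: openI].
- exact: mm.
- by move=> x [[_ ?] nK]; split => // ?; apply: nK; right.
Qed.

Section unit_interval.
Variable m : {measure set Gamma -> \bar R}.
Hypotheses (mT : m setT < +oo) (sm : sandwiched m).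
Let M := fine (m setT).
Let ME : m setT = M%:E.
Proof. by rewrite fineK// ge0_fin_numE. Qed.
Let M0 : (0 <= M)%R. Proof. exact: fine_ge0. Qed.

(** A polynomial that separates K from the complement of U is close to 1_A except
    on U \ K, a set of small measure. *)
Lemma trig_approx_indic (A : set Gamma) (e : R) : measurable A -> (0 < e)%R ->
  exists f : dual R G -> R, [/\ real_trig f, (forall g, 0 <= f g <= 1)%R &
    \int[m]_g `|\1_A g - f g|%:E <= e%:E].
Proof.
move=> mA e0; have e20 : (0 < e / 2)%R by rewrite divr_gt0.
have [K [U [cK oU KA AU UK]]] := sm mA e20.
have d0 : (0 < e / 2 / (M + 1))%R by rewrite divr_gt0// ltr_wpDl.
have [f [Tf f01 fK fU]] := trig_urysohn cK oU (subset_trans KA AU) d0.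
set d := (_ / (M + 1))%R in d0 fK fU.
exists f; split => //.
have mUK : measurable (U `\` K : set Gamma).
  by apply: measurableD; [exact: open_borel|exact: compact_borel].
apply: (@le_trans _ _ (\int[m]_g (d%:E + (\1_(U `\` K) g)%:E))).
  apply: ge0_le_integral => //.
  - apply/measurable_EFinP; apply: measurableT_comp => //.
    by apply: measurable_funB => //; exact: real_trig_measurable.
  - apply/measurable_EFinP; apply: measurable_funD => //.
  - move=> g _; rewrite -EFinD lee_fin.
    rewrite !indicE; have /andP[f0 f1] := f01 g.
    have [Kg|nKg] := pselect (K g).
      rewrite (mem_set (KA _ Kg)) /= memNset; last by case.
      by rewrite addr0 ger0_norm ?subr_ge0//; have := fK _ Kg; lra.
    have [Ug|nUg] := pselect (U g).
      rewrite (_ : g \in U `\` K)/=; last by rewrite inE; split.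
      by rewrite ler_norml; case: (g \in A) => /=; apply/andP; split; lra.
    rewrite memNset /=; last by move/AU.
    rewrite memNset /=; last by case.
    by rewrite sub0r normrN ger0_norm// addr0 fU.
rewrite ge0_integralD//; last 2 first.
- by move=> g _; rewrite lee_fin ltW.
- exact/measurable_EFinP.
rewrite integral_cst// ME integral_indic// setIT.
rewrite (splitr e) EFinD leeD// ?(ltW UK)// -EFinM lee_fin.
by rewrite /d mulrAC ler_pdivrMr ?ltr_wpDl// ler_wpM2l ?(ltW e20)// lerDl.
Qed.

(** Binary expansion of h: with A = {h >= 1/2}, the function h' = 2 h - 1_A again
    takes its values in [0, 1] and h = (1_A + h') / 2, so each step halves the
    error that does not come from the approximation of sets. *)
Let approx_dyadic n (h : Gamma -> R) (e : R) : measurable_fun setT h ->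
  (forall g, 0 <= h g <= 1)%R -> (0 < e)%R ->
  exists f : dual R G -> R, [/\ real_trig f, (forall g, 0 <= f g <= 1)%R &
    \int[m]_g `|h g - f g|%:E <= ((1 / 2) ^+ n * M + e)%:E].
Proof.
elim: n h e => [|n IH] h e mh h01 e0.
  exists (fun=> 0%R); split; first exact: real_trig_cst.
    by move=> _; rewrite lexx ler01.
  rewrite expr0 mul1r EFinD; apply: (@le_trans _ _ M%:E); last first.
    by rewrite leeDl// lee_fin ltW.
  rewrite -ME -[leRHS]mul1e -integral_cst//; apply: ge0_le_integral => //.
    apply/measurable_EFinP; apply: measurableT_comp => //.
    exact: measurable_funB.
  by move=> g _; rewrite subr0 lee_fin; have /andP[? ?] := h01 g; rewrite ger0_norm.
pose A := [set g : Gamma | 1 / 2 <= h g]%R.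
have mA : measurable A.
  rewrite (_ : A = setT `&` h @^-1` `[1 / 2, +oo[%classic)%R.
    exact: mh.
  by rewrite setTI; apply/seteqP; split => g /=; rewrite in_itv/= andbT.
pose h' g := (2 * h g - \1_A g)%R.
have mh' : measurable_fun setT h'.
  by apply: measurable_funB => //; exact: measurable_funM.
have h'01 g : (0 <= h' g <= 1)%R.
  have := h01 g; rewrite /h' indicE; case: (boolP (g \in A)).
    by rewrite inE /A /= => ?; lra.
  by move/negP; rewrite inE /A /= => /negP; rewrite -ltNge => ?; lra.
have [f1 [Tf1 f101 e1]] := trig_approx_indic mA e0.
have [f2 [Tf2 f201 e2]] := IH _ _ mh' h'01 e0.
exists (fun g => 1 / 2 * (f1 g + f2 g))%R; split.
- by apply: real_trigM; [exact: real_trig_cst|exact: real_trigD].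
- by move=> g; have := f101 g; have := f201 g; lra.
have mf1 := real_trig_measurable Tf1; have mf2 := real_trig_measurable Tf2.
have m1 : measurable_fun setT (fun g : Gamma => `|\1_A g - f1 g|%:E).
  by apply/measurable_EFinP; apply: measurableT_comp => //; exact: measurable_funB.
have m2 : measurable_fun setT (fun g : Gamma => `|h' g - f2 g|%:E).
  by apply/measurable_EFinP; apply: measurableT_comp => //; exact: measurable_funB.
apply: (@le_trans _ _ (\int[m]_g ((1 / 2)%:E * (`|\1_A g - f1 g|%:E + `|h' g - f2 g|%:E)))).
  apply: ge0_le_integral => //.
  - apply/measurable_EFinP; apply: measurableT_comp => //.
    by apply: measurable_funB => //; apply: measurable_funM => //; exact: measurable_funD.
  - by apply: measurable_funeM; exact: emeasurable_funD.
  - move=> g _; rewrite -EFinD -EFinM lee_fin.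
    have -> : (h g - 1 / 2 * (f1 g + f2 g) =
               1 / 2 * ((\1_A g - f1 g) + (h' g - f2 g)))%R.
      by rewrite /h'; field.
    rewrite normrM ger0_norm; last by lra.
    by rewrite ler_wpM2l ?ler_normD//; lra.
rewrite ge0_integralZl_EFin//; last 2 first.
- by move=> g _; rewrite adde_ge0.
- exact: emeasurable_funD.
rewrite ge0_integralD//.
apply: (le_trans (lee_wpmul2l _ (leeD e1 e2))); first by rewrite lee_fin; lra.
by rewrite -EFinD -EFinM lee_fin exprS; lra.
Qed.

Lemma trig_approx_unit (h : Gamma -> R) (e : R) : measurable_fun setT h ->
  (forall g, 0 <= h g <= 1)%R -> (0 < e)%R ->
  exists f : dual R G -> R, [/\ real_trig f, (forall g, 0 <= f g <= 1)%R &
    \int[m]_g `|h g - f g|%:E <= e%:E].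
Proof.
move=> mh h01 e0; have e20 : (0 < e / 2)%R by rewrite divr_gt0.
have d0 : (0 < e / 2 / (M + 1))%R by rewrite divr_gt0// ltr_wpDl.
have [n nd] : exists n, ((1 / 2) ^+ n < e / 2 / (M + 1) :> R)%R.
  have : (`|1 / 2| < 1 :> R)%R by rewrite ger0_norm//; lra.
  move=> /cvg_expr /cvgrPdist_lt /(_ _ d0) [n _ /(_ n (leqnn n))] /=.
  rewrite sub0r normrN ger0_norm; first by exists n.
  by rewrite exprn_ge0.
have [f [Tf f01 fe]] := approx_dyadic n mh h01 e20.
exists f; split => //; apply: (le_trans fe); rewrite lee_fin.
have : ((1 / 2) ^+ n * M <= e / 2)%R; last by lra.
rewrite ltr_pdivlMr ?ltr_wpDl// in nd; apply: le_trans (ltW nd).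
by rewrite ler_wpM2l ?exprn_ge0// lerDl.
Qed.

End unit_interval.

End density.

Lemma integral_truncation d (T : measurableType d) (R : realType)
    (m : {measure set T -> \bar R}) (p e : R) (h : T -> R) :
  0 < p -> measurable_fun setT h -> (forall x, 0 <= h x) ->
  (\int[m]_x (h x `^ p)%:E < +oo)%E -> 0 < e ->
  \forall n \near \oo,
    (\int[m]_x ((h x - Num.min (h x) n%:R) `^ p)%:E < e%:E)%E.
Proof.
move=> p0 mh h0 hp e0.
pose u n x := ((h x - Num.min (h x) n%:R) `^ p)%:E.
have hmin n x : 0 <= h x - Num.min (h x) n%:R <= h x.
  by rewrite subr_ge0 ge_min lexx/= gerBl le_min h0 ler0n.
have mu_ n : measurable_fun setT (u n).
  apply/measurable_EFinP; apply: (measurableT_comp (measurable_powR _)).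
  by apply: measurable_funB => //; exact: measurable_minr.
have mhp : measurable_fun setT (fun x => (h x `^ p)%:E).
  by apply/measurable_EFinP; exact: (measurableT_comp (measurable_powR _)).
have ig : m.-integrable setT (fun x => (h x `^ p)%:E).
  apply/integrableP; split => //.
  by under eq_integral do rewrite gee0_abs ?lee_fin ?powR_ge0//.
have [||_ _] := @dominated_convergence _ _ _ m setT measurableT u (cst 0%E)
  (fun x => (h x `^ p)%:E) mu_ (measurable_cst _) _ ig _.
- apply: aeW => x _; apply: cvg_near_cst.
  exists (Num.truncn (h x)).+1 => // n /= hn; rewrite /u.
  rewrite (min_idPl _) ?subrr ?powR0 ?gt_eqF//.
  by rewrite ltW// (lt_le_trans (truncnS_gt _))// ler_nat.
- apply: aeW => x n _; rewrite gee0_abs ?lee_fin ?powR_ge0//.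
  have /andP[? ?] := hmin n x.
  by rewrite ge0_ler_powR// ?nnegrE// ltW.
rewrite integral0 => cvg0.
apply: (cvg0 [set x | (x < e%:E)%E]); apply: open_nbhs_nbhs; split.
  exact: open_ereal_lt_ereal.
by rewrite /= lte_fin.
Qed.

Section Lp_density.
Context (R : realType) (G : zmodType).
Local Notation Gamma := (borel (dual R G)).
Variables (m1 m2 : {measure set Gamma -> \bar R}).
Hypotheses (m1T : (m1 setT < +oo)%E) (m2T : (m2 setT < +oo)%E).
Hypotheses (sm1 : sandwiched m1) (sm2 : sandwiched m2).

(** The same polynomial approximates h in the mean for one measure and in the
    p-th mean for the other. Truncation and scaling reduce to h with values in
    [0, 1]; there
    the error is at most 1, so its p-th power is dominated by the error itself. *)
Lemma trig_dense (p e : R) (h : Gamma -> R) : 1 < p ->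
  measurable_fun setT h -> (forall x, 0 <= h x) ->
  (\int[m1]_x (h x)%:E < +oo)%E -> (\int[m2]_x (h x `^ p)%:E < +oo)%E ->
  0 < e -> exists f : dual R G -> R, [/\ real_trig f,
    (\int[m1]_x (`|h x - f x|)%:E < e%:E)%E &
    (\int[m2]_x (`|h x - f x| `^ p)%:E < e%:E)%E].
Proof.
move=> p1 mh h0 h1oo h2oo e0; have p0 : 0 < p by rewrite (lt_trans _ p1).
have e20 : 0 < e / 2 by rewrite divr_gt0.
have P0 : 0 < 2 `^ p :> R by rewrite powR_gt0.
have e30 : 0 < e / 2 / 2 `^ p by rewrite divr_gt0.
have h1oo' : (\int[m1]_x (h x `^ 1)%:E < +oo)%E.
  by under eq_integral do rewrite powRr1//.
have [n1 _ N1] := integral_truncation ltr01 mh h0 h1oo' e20.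
have [n2 _ N2] := integral_truncation p0 mh h0 h2oo e30.
pose n := (maxn n1 n2).+1; set N : R := n%:R.
have Npos : 0 < N by rewrite ltr0n.
have {}N1 := N1 n (leq_trans (leq_maxl n1 n2) (leqnSn _)).
have {}N2 := N2 n (leq_trans (leq_maxr n1 n2) (leqnSn _)).
rewrite /= in N1 N2.
pose k x := Num.min (h x) N / N.
have mmin : measurable_fun setT (fun x => Num.min (h x) N).
  exact: measurable_minr.
have mk : measurable_fun setT k by apply: measurable_funM.
have k01 x : 0 <= k x <= 1.
  rewrite divr_ge0 ?(ltW Npos) ?le_min ?h0 ?(ltW Npos)//=.
  by rewrite ler_pdivrMr// mul1r ge_min lexx orbT.
have NP0 : 0 < 2 `^ p * N `^ p by rewrite mulr_gt0// powR_gt0.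
(* the first bound serves m1, the second m2 *)
pose eta := Num.min (e / 2 / N) (e / 2 / (2 `^ p * N `^ p)).
have eta0 : 0 < eta by rewrite lt_min !divr_gt0.
pose m := measure_add m1 m2.
have mT : (m setT < +oo)%E by rewrite [ltLHS](measure_addE m1 m2) lte_add_pinfty.
have [f [Tf f01 fk]] := trig_approx_unit mT (sandwiched_add sm1 sm2) mk k01 eta0.
have mf := real_trig_measurable Tf.
have mkf : measurable_fun setT (fun x : Gamma => `|k x - f x|).
  by apply: measurableT_comp => //; exact: measurable_funB.
have mkfE : measurable_fun setT (fun x : Gamma => `|k x - f x|%:E).
  exact/measurable_EFinP.
move: fk; rewrite ge0_integral_measure_add// => fk.
have fk1 : (\int[m1]_x `|k x - f x|%:E <= eta%:E)%E.
  by apply: le_trans fk; rewrite leeDl// integral_ge0.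
have fk2 : (\int[m2]_x `|k x - f x|%:E <= eta%:E)%E.
  by apply: le_trans fk; rewrite leeDr// integral_ge0.
have fin (m' : {measure set Gamma -> \bar R}) : (\int[m']_x `|k x - f x|%:E <= eta%:E)%E ->
    (\int[m']_x `|k x - f x|%:E)%E \is a fin_num.
  by move=> le; rewrite ge0_fin_numE ?integral_ge0//; exact: le_lt_trans le (ltry _).
have fin1 := fin _ fk1; have fin2 := fin _ fk2.
exists (fun x => N * f x); split.
- by apply: real_trigM => //; exact: real_trig_cst.
- have ptw x : `|h x - N * f x| <= (h x - Num.min (h x) N) `^ 1 + N * `|k x - f x|.
    have dge : 0 <= h x - Num.min (h x) N by rewrite subr_ge0 ge_min lexx.
    have -> : h x - N * f x = (h x - Num.min (h x) N) + N * (k x - f x).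
      by rewrite mulrBr /k mulrCA mulfV ?gt_eqF// mulr1 addrA subrK.
    rewrite powRr1// (le_trans (ler_normD _ _))// normrM (gtr0_norm Npos).
    by rewrite lerD2r ger0_norm.
  apply: (@le_lt_trans _ _ (\int[m1]_x
      (((h x - Num.min (h x) N)%R `^ 1)%:E + N%:E * `|k x - f x|%:E))%E).
    apply: ge0_le_integral => //.
    + apply/measurable_EFinP; apply: measurableT_comp => //.
      by apply: measurable_funB => //; exact: measurable_funM.
    + apply: emeasurable_funD; last exact: measurable_funeM.
      apply/measurable_EFinP; apply: (measurableT_comp (measurable_powR _)).
      exact: measurable_funB.
    + by move=> x _; rewrite -EFinM -EFinD lee_fin.
  rewrite ge0_integralD//; last 4 first.
  + by move=> x _; rewrite lee_fin powR_ge0.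
  + apply/measurable_EFinP; apply: (measurableT_comp (measurable_powR _)).
    exact: measurable_funB.
  + by move=> x _; rewrite -EFinM lee_fin mulr_ge0 ?(ltW Npos).
  + exact: measurable_funeM.
  rewrite ge0_integralZl_EFin// ?(ltW Npos)//.
  rewrite (splitr e) EFinD lte_leD//.
    by rewrite fin_numM.
  apply: (@le_trans _ _ (N%:E * eta%:E)%E); first by rewrite lee_wpmul2l// lee_fin ltW.
  by rewrite -EFinM lee_fin mulrC -ler_pdivlMr// ge_min lexx.
- have ptw x : `|h x - N * f x| `^ p <=
      2 `^ p * (h x - Num.min (h x) N) `^ p + 2 `^ p * N `^ p * `|k x - f x|.
    have dge : 0 <= h x - Num.min (h x) N by rewrite subr_ge0 ge_min lexx.
    have -> : h x - N * f x = (h x - Num.min (h x) N) + N * (k x - f x).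
      by rewrite mulrBr /k mulrCA mulfV ?gt_eqF// mulr1 addrA subrK.
    apply: (le_trans (powR_normD _ _ p0)).
    rewrite mulrDr ger0_norm// lerD2l -mulrA ler_wpM2l ?powR_ge0//.
    rewrite normrM gtr0_norm// powRM ?(ltW Npos)// ler_wpM2l ?powR_ge0//.
    have le1 : `|k x - f x| <= 1.
      have /andP[? ?] := k01 x; have /andP[? ?] := f01 x.
      by rewrite ler_norml; apply/andP; split; lra.
    have [->|kf0] := eqVneq `|k x - f x| 0; first by rewrite powR0 ?gt_eqF.
    by rewrite ge1r_powR// ?lt0r ?kf0 ?normr_ge0 ?le1 ?ltW.
  apply: (@le_lt_trans _ _ (\int[m2]_x
      ((2 `^ p)%R%:E * ((h x - Num.min (h x) N)%R `^ p)%:E +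
       (2 `^ p * N `^ p)%R%:E * `|k x - f x|%:E))%E).
    apply: ge0_le_integral => //.
    + apply/measurable_EFinP; apply: (measurableT_comp (measurable_powR _)).
      apply: measurableT_comp => //.
      by apply: measurable_funB => //; exact: measurable_funM.
    + apply: emeasurable_funD; last exact: measurable_funeM.
      apply: measurable_funeM.
      apply/measurable_EFinP; apply: (measurableT_comp (measurable_powR _)).
      exact: measurable_funB.
    + by move=> x _; rewrite -!EFinM -EFinD lee_fin.
  rewrite ge0_integralD//; last 4 first.
  + by move=> x _; rewrite -EFinM lee_fin mulr_ge0 ?powR_ge0.
  + apply: measurable_funeM.
    apply/measurable_EFinP; apply: (measurableT_comp (measurable_powR _)).
    exact: measurable_funB.
  + by move=> x _; rewrite -EFinM lee_fin !mulr_ge0 ?powR_ge0.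
  + exact: measurable_funeM.
  rewrite ge0_integralZl_EFin// ?(ltW P0)//; last 2 first.
  + by move=> x _; rewrite lee_fin powR_ge0.
  + apply/measurable_EFinP; apply: (measurableT_comp (measurable_powR _)).
    exact: measurable_funB.
  rewrite ge0_integralZl_EFin// ?(ltW NP0)//.
  have fin3 : (\int[m2]_x ((h x - Num.min (h x) N) `^ p)%:E)%E \is a fin_num.
    rewrite ge0_fin_numE; first by rewrite (lt_trans N2) ?ltry.
    by apply: integral_ge0 => x _; rewrite lee_fin powR_ge0.
  rewrite (splitr e) EFinD lte_leD//.
  + by rewrite fin_numM.
  + rewrite -(@fineK _ (integral _ _ _))// -EFinM lte_fin mulrC -ltr_pdivlMr//.
    by rewrite -lte_fin fineK.
  apply: (@le_trans _ _ ((2 `^ p * N `^ p)%R%:E * eta%:E)%E).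
    by rewrite lee_wpmul2l// lee_fin ltW.
  by rewrite -EFinM lee_fin mulrC -ler_pdivlMr// ge_min lexx orbT.
Qed.

End Lp_density.

(** * The closure of the trigonometric polynomials *)

Section Lnorm_power.
Context d (T : measurableType d) (R : realType).
Variable m : {measure set T -> \bar R}.
Implicit Types (f g : T -> R) (p e : R).
Local Open Scope ereal_scope.

Lemma int_powR_ge0 p f : 0 <= \int[m]_x (f x `^ p)%:E.
Proof. by apply: integral_ge0 => x _; rewrite lee_fin powR_ge0. Qed.

Lemma Lnorm_powR p f : (forall x, 0 <= f x)%R ->
  'N[m]_(p%:E)[EFin \o f] = (\int[m]_x (f x `^ p)%:E) `^ (p^-1).
Proof.
move=> f0; rewrite unlock /Lnorm; congr (_ `^ _).
by apply: eq_integral => x _ /=; rewrite ger0_norm.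
Qed.

Lemma Lnorm_lt p e f : (0 < p)%R -> (0 < e)%R -> (forall x, 0 <= f x)%R ->
  ('N[m]_(p%:E)[EFin \o f] < e%:E) = (\int[m]_x (f x `^ p)%:E < (e `^ p)%:E).
Proof.
move=> p0 e0 f0; rewrite Lnorm_powR//; have := int_powR_ge0 p f.
case: (integral _ _ _) => [r| |]//; last first.
  by move=> _; rewrite poweRyr ?invr_neq0 ?gt_eqF.
rewrite lee_fin => r0; rewrite poweR_EFin !lte_fin.
have pV0 : (0 < p^-1)%R by rewrite invr_gt0.
have eE : e = ((e `^ p) `^ p^-1)%R by rewrite -powRrM mulfV ?gt_eqF// powRr1// ltW.
apply/idP/idP => [h|h].
  have := gt0_ltr_powR p0 _ _ h; rewrite !nnegrE powR_ge0 (ltW e0).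
  by rewrite -powRrM mulVf ?gt_eqF// powRr1//; exact.
rewrite [ltRHS]eE.
by apply: gt0_ltr_powR; rewrite ?nnegrE ?powR_ge0.
Qed.

End Lnorm_power.

Section Lp_closure.
Context (R : realType) (G : zmodType).
Local Notation C := R[i]%C.
Local Notation Gamma := (borel (dual R G)).
Variable nu : {measure set Gamma -> \bar R}.
Variables (p : R) (S : set G).
Hypothesis p1 : 1 < p.
Let p0 : 0 < p. Proof. exact: lt_trans p1. Qed.
Implicit Types (f phi tau : Gamma -> C).
Local Open Scope ereal_scope.

Lemma int_powE f : int_pow nu p f = \int[nu]_g (normc (1 - f g)%R `^ p)%:E.
Proof. by []. Qed.

Lemma int_pow_ge0 f : 0 <= int_pow nu p f.
Proof. by apply: integral_ge0 => x _; rewrite lee_fin powR_ge0. Qed.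

Lemma d_ge0 : 0 <= d_ p nu S.
Proof. by apply: le_ereal_inf_tmp => _ [tau _ <-]; exact: int_pow_ge0. Qed.

Lemma d_le tau : trig_poly S tau -> d_ p nu S <= int_pow nu p tau.
Proof. by move=> Stau; apply: ereal_inf_lbound; exists tau. Qed.

Lemma complex_Lp_cmeasurable f : complex_Lp nu p f -> cmeasurable f.
Proof. by move=> [mf _]; split; [exact: measurable_Re|exact: measurable_Im]. Qed.

Lemma Lp_closure_cmeasurable f : Lp_closure nu p (trig_poly S) f ->
  cmeasurable f.
Proof. by move=> [/complex_Lp_cmeasurable]. Qed.

Lemma Lp_closure_approx phi e : Lp_closure nu p (trig_poly S) phi ->
  (0 < e)%R -> exists2 tau, trig_poly S tau &
    \int[nu]_g (normc (phi g - tau g)%R `^ p)%:E < e%:E.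
Proof.
move=> [_ cl] e0; have [tau Stau] := cl (e `^ p^-1)%R (powR_gt0 _ e0).
rewrite Lnorm_lt ?powR_gt0//; last by move=> g; exact: normc_ge0.
rewrite -powRrM mulVf ?gt_eqF// powRr1 ?ltW// => h.
by exists tau.
Qed.

(** By Minkowski's inequality the p-th root of the distance is at most
    |1 - phi|_p + e for every e > 0. *)
Lemma d_le_closure phi : Lp_closure nu p (trig_poly S) phi ->
  d_ p nu S <= int_pow nu p phi.
Proof.
move=> cl; have mphi := Lp_closure_cmeasurable cl.
have [->|phioo] := eqVneq (int_pow nu p phi) +oo; first exact: leey.
have m1phi := cmeasurable_normc (cmeasurableB (cmeasurable_cst _ 1%R) mphi).
pose X := 'N[nu]_(p%:E)[EFin \o (fun g => normc (1 - phi g)%R)].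
have XE : X = (int_pow nu p phi) `^ p^-1.
  by rewrite /X Lnorm_powR// => g; exact: normc_ge0.
have step e : (0 < e)%R -> d_ p nu S <= (X + e%:E) `^ p.
  move=> e0; have [_ /(_ e e0)[tau Stau htau]] := cl.
  have mtau := trig_poly_cmeasurable Stau.
  apply: (le_trans (d_le Stau)).
  have m1tau := cmeasurable_normc (cmeasurableB (cmeasurable_cst _ 1%R) mtau).
  have mpt := cmeasurable_normc (cmeasurableB mphi mtau).
  apply: (@le_trans _ _ ('N[nu]_(p%:E)[EFin \o
      ((fun g => normc (1 - phi g)) \+ (fun g => normc (phi g - tau g)))%R] `^ p)).
    rewrite Lnorm_powR; last by move=> g; rewrite addr_ge0 ?normc_ge0.
    rewrite -poweRrM mulVf ?gt_eqF// poweRe1 ?int_powR_ge0//.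
    apply: ge0_le_integral => //.
    - by move=> g _; rewrite lee_fin powR_ge0.
    - by apply/measurable_EFinP; exact: (measurableT_comp (measurable_powR _)).
    - apply/measurable_EFinP; apply: (measurableT_comp (measurable_powR _)).
      exact: measurable_funD.
    - move=> g _; rewrite lee_fin ge0_ler_powR ?(ltW p0)// ?nnegrE ?addr_ge0 ?normc_ge0//.
      rewrite (le_trans _ (le_normcD _ _))//.
      by rewrite addrA subrK.
  apply: gt0_ler_poweR; rewrite ?(ltW p0)//.
  - by rewrite in_itv/= Lnorm_ge0 leey.
  - by rewrite in_itv/= leey andbT adde_ge0 ?Lnorm_ge0// lee_fin ltW.
  have mk := minkowski_EFin nu m1phi mpt (ltW p1).
  apply: (le_trans mk).
  by rewrite leeD2l// ltW.
have := int_pow_ge0 phi; move: phioo XE.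
case: (int_pow nu p phi) => [r| |]// _ XE; rewrite lee_fin => r0.
rewrite poweR_EFin in XE; rewrite XE in step.
have := step 1%R ltr01; have := d_ge0.
case dE : (d_ p nu S) => [D| |]//; rewrite lee_fin => D0 _.
have DE : (D = (D `^ p^-1) `^ p)%R by rewrite -powRrM mulVf ?gt_eqF// powRr1.
have rE : (r = (r `^ p^-1) `^ p)%R by rewrite -powRrM mulVf ?gt_eqF// powRr1.
rewrite lee_fin DE rE ge0_ler_powR ?(ltW p0) ?nnegrE ?powR_ge0//.
apply/ler_addgt0Pr => e e0; have := step e e0; rewrite dE -EFinD poweR_EFin lee_fin => h.
have pV0 : (0 <= p^-1)%R by rewrite invr_ge0 ltW.
have a0 : (0 <= r `^ p^-1 + e)%R by rewrite addr_ge0 ?powR_ge0// ltW.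
have := ge0_ler_powR pV0 _ _ h; rewrite !nnegrE D0 powR_ge0.
by rewrite -[X in _ -> _ -> is_true (_ <= X)%R]powRrM mulfV ?gt_eqF// powRr1//; exact.
Qed.

Lemma complex_Lp_real (h : Gamma -> R) : nu setT < +oo ->
  measurable_fun setT h ->
  \int[nu]_g (`|h g| `^ p)%:E < +oo ->
  complex_Lp nu p (fun g => (1 - h g)%:C%C).
Proof.
move=> nT mh hoo; split.
  by apply: measurable_real_complex; exact: measurable_funB.
rewrite /finite_norm Lnorm_powR; last by move=> g; exact: normc_ge0.
apply: poweR_lty.
have mhp : measurable_fun setT (fun g => (`|h g| `^ p)%:E).
  apply/measurable_EFinP; apply: (measurableT_comp (measurable_powR _)).
  exact: measurableT_comp.
apply: (@le_lt_trans _ _ (\int[nu]_g ((2 `^ p)%R%:E * (1 + (`|h g| `^ p)%:E)))).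
  apply: ge0_le_integral => //.
  - by move=> g _; rewrite lee_fin powR_ge0.
  - apply/measurable_EFinP; apply: (measurableT_comp (measurable_powR _)).
    apply: cmeasurable_normc; split => /=; last exact: measurable_cst.
    exact: measurable_funB.
  - by apply: measurable_funeM; exact: emeasurable_funD.
  - move=> g _; rewrite -EFinD -EFinM lee_fin /= expr0n addr0 sqrtr_sqr.
    by have := powR_normD 1 (- h g) p0; rewrite normr1 powR1 normrN.
rewrite ge0_integralZl_EFin ?powR_ge0//; last 2 first.
- by move=> g _; rewrite adde_ge0// lee_fin powR_ge0.
- exact: emeasurable_funD.
rewrite ge0_integralD//.
rewrite integral_cst// mul1e lte_mul_pinfty ?lee_fin ?powR_ge0//.
by rewrite lte_add_pinfty.
Qed.

End Lp_closure.

(** * The metric projection *)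

Section projection.
Context (R : realType) (G : zmodType).
Local Notation C := R[i]%C.
Local Notation Gamma := (borel (dual R G)).
Local Notation S := [set x : G | x != 0].
Variables (lambda : probability Gamma R) (haar : is_haar lambda).
Hypothesis sep : forall x : G, x != 0 -> exists g : dual R G, pairing g x != 1.
Variable p : R.
Hypothesis p1 : 1 < p.
Let p0 : 0 < p. Proof. exact: lt_trans p1. Qed.
Let lT : (lambda setT < +oo)%E. Proof. by rewrite probability_setT ltry. Qed.

Local Open Scope ereal_scope.

Let mean_cst (r : R) : (\int[lambda]_g r = r)%R.
Proof.
rewrite (Rintegral_cst lambda measurableT r) -[RHS]mulr1; congr (_ * _)%R.
exact: (congr1 (@fine R) (probability_setT lambda) : _ = fine 1).
Qed.

(** The real part of 1 - tau has mean one. *)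
Lemma trig_poly_mean (tau : Gamma -> C) : trig_poly S tau ->
  1 <= \int[lambda]_g (normc (1 - tau g)%R)%:E.
Proof.
move=> Stau; have [ir _] := trig_poly_integrable lT Stau.
have [re0 _] := haar_trig_poly haar sep Stau.
have i1 : lambda.-integrable setT (EFin \o (fun=> 1%R)).
  by apply: (finite_measure_integrable_cst _ _ measurableT).
have i1r : lambda.-integrable setT (EFin \o (fun g => 1 - complex.Re (tau g))%R).
  by have := integrableB measurableT i1 ir.
have e1 : (\int[lambda]_g (1 - complex.Re (tau g)) = 1)%R.
  by rewrite RintegralB// re0 subr0 mean_cst.
have := le_normr_Rintegral measurableT i1r; rewrite e1 normr1 -lee_fin.
have mtau := trig_poly_cmeasurable Stau.
move=> /le_trans; apply.
rewrite /Rintegral fineK; last first.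
  by apply: (integrable_fin_num measurableT); exact: (integrable_norm i1r).
apply: ge0_le_integral => //.
- apply/measurable_EFinP; apply: measurableT_comp => //.
  by apply: measurable_funB => //; case: mtau.
- apply/measurable_EFinP.
  exact: cmeasurable_normc (cmeasurableB (cmeasurable_cst _ 1%R) mtau).
- move=> g _; rewrite lee_fin (le_trans _ (ler_norm_Re _))//.
  by case: (tau g).
Qed.

Section density.
Variable nu : {measure set Gamma -> \bar R}.
Hypotheses (nT : nu setT < +oo) (reg_nu : regular nu).
Variable v : Gamma -> R.
Hypotheses (v0 : forall g, (0 <= v g)%R) (mv : measurable_fun setT v).
Hypothesis nuE : forall f : Gamma -> R, measurable_fun setT f ->
  (forall g, (0 <= f g)%R) ->
  \int[nu]_g (f g)%:E = \int[lambda]_g (f g * v g)%:E.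

Let nuE_pow (f : Gamma -> R) : measurable_fun setT f ->
  \int[nu]_g (f g `^ p)%:E = energy lambda p v f.
Proof.
move=> mf; rewrite nuE//; first exact: (measurableT_comp (measurable_powR _)).
by move=> g; rewrite powR_ge0.
Qed.

(** Approximate h by a real trigonometric polynomial f = c + tau with tau in T(S).
    As tau has mean zero, c is the mean of f, which is close to the mean 1 of h;
    hence - tau is close to 1 - h. *)
Lemma mean_one_closure (h : Gamma -> R) : measurable_fun setT h ->
  (forall g, (0 <= h g)%R) -> \int[lambda]_g (h g)%:E = 1 ->
  \int[nu]_g (h g `^ p)%:E < +oo ->
  Lp_closure nu p (trig_poly S) (fun g => (1 - h g)%:C%C).
Proof.
move=> mh h0 h1 hp; split.
  apply: complex_Lp_real => //.
  by under eq_integral do rewrite (ger0_norm (h0 _)).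
move=> e e0; pose M := fine (nu setT).
have ME : nu setT = M%:E by rewrite fineK// ge0_fin_numE.
have M0 : (0 <= M)%R by exact: fine_ge0.
have P0 : (0 < 2 `^ p :> R)%R by rewrite powR_gt0.
have E0 : (0 < e `^ p)%R by rewrite powR_gt0.
have M10 : (0 < M + 1)%R by rewrite ltr_wpDl.
(* eta <= 1 gives eta^p <= eta *)
pose eta := Num.min 1%R (e `^ p / 2 / (2 `^ p * (M + 1)))%R.
have eta0 : (0 < eta)%R by rewrite lt_min ltr01 !divr_gt0// mulr_gt0.
have hoo : \int[lambda]_g (h g)%:E < +oo by rewrite h1 ltry.
have [f [Tf fl fn]] := trig_dense lT nT (regular_sandwiched lT (proj1 haar))
  (regular_sandwiched nT reg_nu) p1 mh h0 hoo hp eta0.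
have mf := real_trig_measurable Tf.
have [c [tau [Stau fE]]] := trig_poly_split Tf.
have fEg g : (f g)%:C%C = (c + tau g)%R by have := congr1 (@^~ g) fE.
have [ir ii] := trig_poly_integrable lT Stau.
have [re0 im0] := haar_trig_poly haar sep Stau.
have [fr _] := trig_poly_integrable lT Tf.
have cst (a : R) : lambda.-integrable setT (EFin \o (fun=> a)).
  by apply: (finite_measure_integrable_cst _ _ measurableT).
have cR : (\int[lambda]_g f g = complex.Re c)%R.
  under eq_Rintegral => g _.
    rewrite (_ : f g = complex.Re c + complex.Re (tau g))%R; last first.
      have /(congr1 (@complex.Re R)) /= -> := fEg g.
      by case: c {fE fEg} => ? ?; case: (tau g).
    over.
  by rewrite RintegralD// re0 addr0 mean_cst.
have cI : complex.Im c = 0%R.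
  have : (\int[lambda]_g (complex.Im c + complex.Im (tau g)) = 0)%R.
    under eq_Rintegral => g _.
      rewrite (_ : _ + _ = 0)%R; last first.
        have /(congr1 (@complex.Im R)) /= -> := fEg g.
        by case: c {fE fEg cR} => ? ?; case: (tau g).
      over.
    by rewrite mean_cst.
  by rewrite RintegralD// im0 addr0 mean_cst.
have cE : c = (complex.Re c)%:C%C by move: cI; case: c {fE fEg cR} => ? ? /= ->.
pose a := (1 - complex.Re c)%R.
have mhf : measurable_fun setT (fun g : Gamma => `|h g - f g|%R).
  by apply: measurableT_comp => //; exact: measurable_funB.
have ih : lambda.-integrable setT (EFin \o h).
  apply/integrableP; split; first exact/measurable_EFinP.
  by under eq_integral do rewrite /= (ger0_norm (h0 _)).
have ihf : lambda.-integrable setT (EFin \o (fun g => h g - f g)%R).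
  by have := integrableB measurableT ih fr.
have a_eta : (`|a| <= eta)%R.
  have -> : a = (\int[lambda]_g (h g - f g))%R.
    by rewrite RintegralB// cR /a; congr (_ - _)%R; rewrite /Rintegral h1.
  apply: (le_trans (le_normr_Rintegral measurableT ihf)).
  rewrite -lee_fin /Rintegral fineK ?(ltW fl)//.
  by apply: (integrable_fin_num measurableT); exact: (integrable_norm ihf).
exists (fun g => -1 * tau g)%R; first exact: trig_polyZ.
have normE g : normc ((1 - h g)%:C%C - -1 * tau g)%R = (`|a + (f g - h g)|)%R.
  have -> : ((1 - h g)%:C%C - -1 * tau g = (a + (f g - h g))%:C%C :> C)%R.
    have -> : tau g = ((f g)%:C%C - c)%R by rewrite fEg addrC addKr.
    rewrite cE /a !rmorphD !rmorphN /=; ring.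
  by rewrite /= expr0n addr0 sqrtr_sqr.
rewrite Lnorm_lt//; last by move=> g; exact: normc_ge0.
under eq_integral do rewrite normE.
apply: (@le_lt_trans _ _ (\int[nu]_g ((2 `^ p)%R%:E * (eta%:E + (`|h g - f g| `^ p)%:E)))).
  apply: ge0_le_integral => //.
  - apply/measurable_EFinP; apply: (measurableT_comp (measurable_powR _)).
    apply: measurableT_comp => //; apply: measurable_funD => //.
    exact: measurable_funB.
  - apply: measurable_funeM; apply: emeasurable_funD => //.
    apply/measurable_EFinP; exact: (measurableT_comp (measurable_powR _)).
  - move=> g _; rewrite -EFinD -EFinM lee_fin (le_trans (powR_normD _ _ p0))//.
    rewrite ler_wpM2l ?powR_ge0// (distrC (f g)) lerD2r.
    apply: (@le_trans _ _ (eta `^ p)%R).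
      by rewrite ge0_ler_powR ?(ltW p0) ?nnegrE// ltW.
    by rewrite ge1r_powR ?(ltW p1)// eta0 ge_min lexx.
have mp : measurable_fun setT (fun g : Gamma => (`|h g - f g| `^ p)%:E).
  by apply/measurable_EFinP; exact: (measurableT_comp (measurable_powR _)).
rewrite ge0_integralZl_EFin ?powR_ge0//; last 2 first.
- by move=> g _; rewrite adde_ge0// lee_fin ?powR_ge0// ltW.
- exact: emeasurable_funD.
rewrite ge0_integralD//; last by move=> g _; rewrite lee_fin ltW.
rewrite integral_cst// ME.
apply: (@le_lt_trans _ _ ((2 `^ p)%R%:E * (eta%:E * M%:E + eta%:E))).
  by rewrite lee_wpmul2l ?lee_fin ?powR_ge0// leeD2l// ltW.
rewrite -[ltLHS]/((2 `^ p * (eta * M + eta))%R%:E) lte_fin.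
have : (eta * (2 `^ p * (M + 1)) <= e `^ p / 2)%R.
  by rewrite -ler_pdivlMr ?mulr_gt0// ge_min lexx orbT.
lra.
Qed.

(** Convergence in L^p(nu) implies convergence in L^1(lambda) when v admits a
    balanced t: the inequality balanced_le_energy applied to |phi - tau| / e
    bounds the mean of |phi - tau| by e as soon as its energy is at most e^p k. *)
Lemma closure_mean t k phi : balanced lambda p v t k ->
  Lp_closure nu p (trig_poly S) phi ->
  1 <= \int[lambda]_g (normc (1 - phi g)%R)%:E.
Proof.
move=> bal cl; have mphi := Lp_closure_cmeasurable cl.
have k0 : (0 < k)%R by case: bal.
have pk0 : (0 < p * k)%R by rewrite mulr_gt0.
have m1phi := cmeasurable_normc (cmeasurableB (cmeasurable_cst _ 1%R) mphi).
apply/lee_addgt0Pr => e e0.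
have ek0 : (0 < e `^ p * k)%R by rewrite mulr_gt0// powR_gt0.
have [tau Stau htau] := Lp_closure_approx p1 cl ek0.
have mtau := trig_poly_cmeasurable Stau.
have mpt := cmeasurable_normc (cmeasurableB mphi mtau).
apply: (le_trans (trig_poly_mean Stau)).
apply: (@le_trans _ _ (\int[lambda]_g
    ((normc (1 - phi g)%R)%:E + (normc (phi g - tau g)%R)%:E))).
  apply: ge0_le_integral => //.
  - by move=> g _; rewrite lee_fin normc_ge0.
  - apply/measurable_EFinP.
    exact: cmeasurable_normc (cmeasurableB (cmeasurable_cst _ 1%R) mtau).
  - by apply: emeasurable_funD; exact/measurable_EFinP.
  - move=> g _; rewrite -EFinD lee_fin (le_trans _ (le_normcD _ _))//.
    by rewrite addrA subrK.
rewrite ge0_integralD//; last 4 first.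
- by move=> g _; rewrite lee_fin normc_ge0.
- exact/measurable_EFinP.
- by move=> g _; rewrite lee_fin normc_ge0.
- exact/measurable_EFinP.
rewrite leeD2l//.
pose f g := (e^-1 * normc (phi g - tau g))%R.
have mf : measurable_fun setT f by exact: measurable_funM.
have f0 g : (0 <= f g)%R by rewrite mulr_ge0 ?normc_ge0// invr_ge0 ltW.
have ef : energy lambda p v f <= k%:E.
  rewrite -nuE_pow//.
  under eq_integral => g _.
    rewrite /f powRM ?normc_ge0 ?invr_ge0 ?(ltW e0)// EFinM; over.
  rewrite ge0_integralZl_EFin ?powR_ge0//; last 2 first.
  - by move=> g _; rewrite lee_fin powR_ge0.
  - by apply/measurable_EFinP; exact: (measurableT_comp (measurable_powR _)).
  apply: (@le_trans _ _ ((e^-1 `^ p)%R%:E * (e `^ p * k)%R%:E)).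
    by rewrite lee_wpmul2l ?lee_fin ?powR_ge0// ltW.
  rewrite -EFinM mulrA -powRM ?invr_ge0 ?(ltW e0)//.
  by rewrite mulVf ?gt_eqF// powR1 mul1r.
have := balanced_le_energy p1 mv v0 bal mf f0.
have -> : \int[lambda]_g (f g)%:E = (e^-1)%:E * \int[lambda]_g (normc (phi g - tau g)%R)%:E.
  under eq_integral do rewrite EFinM.
  rewrite ge0_integralZl_EFin ?invr_ge0 ?(ltW e0)//.
  - by move=> g _; rewrite lee_fin normc_ge0.
  - exact/measurable_EFinP.
move=> /le_trans/(_ (leeD2r _ ef)); rewrite muleA -EFinM -EFinD.
have -> : (k + (p - 1) * k = p * k)%R by ring.
case: (integral _ _ _) => [r| |]//.
  rewrite -EFinM !lee_fin -[leRHS]mulr1 -mulrA ler_pM2l//.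
  by rewrite mulrC ler_pdivrMr// mul1r.
  by rewrite mulry gtr0_sg ?mul1e ?leye_eq// mulr_gt0// invr_gt0.
by rewrite leNye.
Qed.

Lemma d_le_mean_one (h : Gamma -> R) : measurable_fun setT h ->
  (forall g, (0 <= h g)%R) -> \int[lambda]_g (h g)%:E = 1 ->
  energy lambda p v h < +oo -> d_ p nu S <= energy lambda p v h.
Proof.
move=> mh h0 h1 hoo; rewrite -nuE_pow// in hoo *.
apply: (le_trans (d_le_closure p1 (mean_one_closure mh h0 h1 hoo))).
rewrite /int_pow le_eqVlt; apply/orP; left; apply/eqP.
apply: eq_integral => g _; congr (_ `^ _)%:E.
by rewrite -(rmorph1 (real_complex R)) -rmorphB /= subKr expr0n addr0 sqrtr_sqr ger0_norm.
Qed.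

Lemma d_lt_pinfty : d_ p nu S < +oo.
Proof.
apply: le_lt_trans (d_le _ _ (trig_poly0 R S)) _.
rewrite int_powE; under eq_integral do rewrite subr0 normc1 powR1.
by rewrite integral_cst// mul1e.
Qed.

(** Otherwise the normalised indicator of {v = 0} has mean one and no energy. *)
Lemma density_gt0 : 0 < d_ p nu S -> {ae lambda, forall g, (0 < v g)%R}.
Proof.
move=> d0; pose A := [set g : Gamma | v g == 0%R].
have mA : measurable A.
  rewrite (_ : A = setT `&` v @^-1` [set 0%R]); first exact: mv.
  by rewrite setTI; apply/seteqP; split => g /= /eqP.
suff A0 : lambda A = 0.
  exists A; split => // g /= /negP; rewrite -leNgt => vg.
  by rewrite /A /= eq_le vg v0.
apply/eqP; apply: contraT => An0.
have Aoo : lambda A < +oo by rewrite (le_lt_trans (probability_le1 _ _)) ?ltry.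
have [a aE] : exists a, lambda A = a%:E.
  by exists (fine (lambda A)); rewrite fineK// ge0_fin_numE.
have a0 : (0 < a)%R.
  by rewrite -lte_fin -aE lt0e An0 measure_ge0.
pose h g := (a^-1 * \1_A g)%R.
have h0 g : (0 <= h g)%R by rewrite mulr_ge0// invr_ge0 ltW.
have mh : measurable_fun setT h by exact: measurable_funM.
have e0 : energy lambda p v h = 0.
  apply: integral0_eq => g _; rewrite /h indicE.
  case: (boolP (g \in A)) => [|_]; first by rewrite inE /A /= => /eqP ->; rewrite mulr0.
  by rewrite mulr0 powR0 ?gt_eqF// mul0r.
have : d_ p nu S <= energy lambda p v h.
  apply: d_le_mean_one => //; last by rewrite e0.
  under eq_integral do rewrite EFinM.
  rewrite ge0_integralZl_EFin ?invr_ge0 ?(ltW a0)//; last exact/measurable_EFinP.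
  have -> : \int[lambda]_g (\1_A g)%:E = a%:E by rewrite integral_indic// setIT.
  by rewrite -EFinM mulVf// gt_eqF.
by rewrite e0 leNgt d0.
Qed.

Let s := ((p - 1)^-1)%R.
Let u g := (v g `^ (- s))%R.
Let pm1 : (0 < p - 1)%R. Proof. by rewrite subr_gt0. Qed.
Let mu_ : measurable_fun setT u.
Proof. exact: (measurableT_comp (measurable_powR _)). Qed.
Let u0 g : (0 <= u g)%R. Proof. exact: powR_ge0. Qed.

Let uv g : (0 < v g)%R -> (u g `^ (p - 1) * v g = 1)%R.
Proof.
move=> vg; rewrite /u -powRrM mulNr mulVf ?gt_eqF// powR_inv1 ?(ltW vg)//.
by rewrite mulVf// gt_eqF.
Qed.

(** Here s = 1/(p-1) and u = v^(-s), so that u^(p-1) v = 1. The truncations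
    h = min(u, n) satisfy h^p v <= h; dividing h by its mean H gives a function
    of mean one and energy at most H^(1-p). As this is at least d_p(nu; S) > 0,
    the means H are bounded, and they increase to the integral of u. *)
Lemma dual_density_lty : 0 < d_ p nu S -> \int[lambda]_g (u g)%:E < +oo.
Proof.
move=> d0; have vpos := density_gt0 d0.
have [D DE] : exists D, d_ p nu S = D%:E.
  by exists (fine (d_ p nu S)); rewrite fineK// ge0_fin_numE ?d_lt_pinfty// ltW.
have D0 : (0 < D)%R by rewrite -lte_fin -DE.
pose h n g := Num.min (u g) n%:R.
have h0 n g : (0 <= h n g)%R by rewrite le_min u0 ler0n.
have mh n : measurable_fun setT (h n) by exact: measurable_minr.
pose B := (D^-1 `^ s)%R.
have bound n : \int[lambda]_g (h n g)%:E <= B%:E.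
  have hoo : \int[lambda]_g (h n g)%:E < +oo.
    apply: (@le_lt_trans _ _ (\int[lambda]_g n%:R%:E)).
      apply: ge0_le_integral => //.
      - by move=> g _; rewrite lee_fin.
      - exact/measurable_EFinP.
      - by move=> g _; rewrite lee_fin ge_min lexx orbT.
    by rewrite integral_cst//; apply: lte_mul_pinfty => //; exact: lT.
  have I0 : 0 <= \int[lambda]_g (h n g)%:E.
    by apply: integral_ge0 => g _; rewrite lee_fin.
  have [H HE] : exists H, \int[lambda]_g (h n g)%:E = H%:E.
    by exists (fine (\int[lambda]_g (h n g)%:E)); rewrite fineK// ge0_fin_numE.
  rewrite HE lee_fin in I0 *.
  have [->|Hn0] := eqVneq H 0%R; first exact: powR_ge0.
  have H0 : (0 < H)%R by rewrite lt0r Hn0.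
  pose h' g := (H^-1 * h n g)%R.
  have mh' : measurable_fun setT h' by exact: measurable_funM.
  have h'0 g : (0 <= h' g)%R by rewrite mulr_ge0// invr_ge0.
  have h'1 : \int[lambda]_g (h' g)%:E = 1.
    under eq_integral do rewrite EFinM.
    rewrite ge0_integralZl_EFin ?invr_ge0//.
    - by rewrite HE -EFinM mulVf.
    - by move=> g _; rewrite lee_fin.
    - exact/measurable_EFinP.
  have eh' : energy lambda p v h' <= (H `^ (1 - p))%:E.
    have -> : (H `^ (1 - p))%:E = \int[lambda]_g ((H `^ (- p))%:E * (h n g)%:E).
      rewrite ge0_integralZl_EFin ?powR_ge0//.
      - rewrite HE -EFinM -{3}(powRr1 I0) -powRD ?Hn0 ?implybT//.
        by rewrite addrC.
      - by move=> g _; rewrite lee_fin.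
      - exact/measurable_EFinP.
    apply: ae_ge0_le_integral => //.
    - by move=> g _; rewrite lee_fin mulr_ge0// powR_ge0.
    - exact: measurable_energy.
    - by move=> g _; rewrite -EFinM lee_fin mulr_ge0// powR_ge0.
    - by apply: measurable_funeM; exact/measurable_EFinP.
    apply: filterS vpos => g vg _; rewrite -EFinM lee_fin /h'.
    rewrite powRM ?invr_ge0// -(powR_inv1 I0) -powRrM mulN1r -mulrA.
    rewrite ler_wpM2l ?powR_ge0//.
    have [->|hn0] := eqVneq (h n g) 0%R; first by rewrite powR0 ?gt_eqF// mul0r.
    rewrite -{1}(subrK 1%R p) (@powRD _ _ (p - 1) 1) ?hn0 ?implybT// powRr1//.
    rewrite -mulrA mulrCA -[leRHS]mulr1 ler_wpM2l// -[leRHS](uv vg).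
    rewrite ler_wpM2r// ge0_ler_powR ?(ltW pm1) ?nnegrE//.
    by rewrite ge_min lexx.
  have := d_le_mean_one mh' h'0 h'1 (le_lt_trans eh' (ltry _)).
  move=> /le_trans/(_ eh'); rewrite DE lee_fin => DH.
  have Hp0 : (0 < H `^ (p - 1))%R by rewrite powR_gt0.
  have {}DH : (H `^ (p - 1) <= D^-1)%R.
    rewrite -[leRHS]mul1r ler_pdivlMr// mulrC -ler_pdivlMr// mul1r.
    by rewrite -powRN opprB.
  have sp0 : (0 <= s)%R by rewrite invr_ge0 ltW.
  have := ge0_ler_powR sp0 _ _ DH; rewrite !nnegrE powR_ge0 invr_ge0 (ltW D0).
  by rewrite -powRrM mulfV ?gt_eqF// powRr1//; exact.
apply: le_lt_trans (ltry B).
have limu : \int[lambda]_g (limn (fun n => (h n g)%:E)) = \int[lambda]_g (u g)%:E.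
  apply: eq_integral => g _; apply/cvg_lim => //; apply: cvg_near_cst.
  exists (Num.truncn (u g)).+1 => // n /= hn; congr EFin.
  by apply/min_idPl; rewrite ltW// (lt_le_trans (truncnS_gt _))// ler_nat.
have hmono g : {homo (fun n => (h n g)%:E) : n m / (n <= m)%N >-> n <= m}.
  move=> m n mn; rewrite lee_fin le_min ge_min lexx/= ge_min.
  by rewrite ler_nat mn orbT.
have cv : (fun n => \int[lambda]_g (h n g)%:E) @ \oo --> \int[lambda]_g (u g)%:E.
  rewrite -limu; apply: cvg_monotone_convergence => [//|n|n g _|g _].
  - exact/measurable_EFinP.
  - by rewrite lee_fin.
  - exact: hmono.
rewrite -(cvg_lim _ cv)//; apply: lime_le; first by apply/cvg_ex; eexists; exact: cv.
by apply: nearW => n; exact: bound.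
Qed.

(** The function t = u / int u is balanced. Hence 1 - t lies in the closure, while
    k, the energy of t, is a lower bound for the energy of every
    1 - tau: thus k is the distance. Any other projection phi makes
    |1 - phi| a function of mean at least one with the same energy, hence equal
    to t. *)
Lemma projection_spec : 0 < d_ p nu S -> exists t k,
  [/\ balanced lambda p v t k, d_ p nu S = k%:E,
      exists phi, is_metric_proj nu p S phi &
      forall phi, is_metric_proj nu p S phi ->
        cmeasurable phi /\ {ae lambda, forall g, normc (1 - phi g)%R = t g}].
Proof.
move=> d0; have vpos := density_gt0 d0; have uoo := dual_density_lty d0.
have [J JE] : exists J, \int[lambda]_g (u g)%:E = J%:E.
  exists (fine (\int[lambda]_g (u g)%:E)); rewrite fineK// ge0_fin_numE//.
  by apply: integral_ge0 => g _; rewrite lee_fin.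
have J0 : (0 <= J)%R.
  by rewrite -lee_fin -JE integral_ge0// => g _; rewrite lee_fin.
have Jn0 : J != 0%R.
  apply/eqP => J00; have mue : measurable_fun setT (fun g => (u g)%:E).
    exact/measurable_EFinP.
  have /(ae_eq_integral_abs lambda measurableT mue) ue0 :
      \int[lambda]_g `|(u g)%:E| = 0.
    under eq_integral do rewrite gee0_abs ?lee_fin//.
    by rewrite JE J00.
  have : {ae lambda, forall g : Gamma, False}.
    move: ue0; apply: filterS2 vpos => g vg ug.
    have {}ug : u g = 0%R by have := EFin_inj (ug Logic.I).
    by have := uv vg; rewrite ug powR0 ?gt_eqF// mul0r => /eqP; rewrite eq_sym oner_eq0.
  move=> [A [mA A0 AT]].
  have := probability_setT lambda; rewrite (_ : setT = A).
    by rewrite A0 => /eqP; rewrite eq_sym onee_eq0.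
  by apply/seteqP; split => // g _; apply: AT.
have Jpos : (0 < J)%R by rewrite lt0r Jn0.
pose t g := (J^-1 * u g)%R.
have mt : measurable_fun setT t by exact: measurable_funM.
have t0 g : (0 <= t g)%R by rewrite mulr_ge0// invr_ge0.
pose k := (J^-1 `^ (p - 1))%R.
have bal : balanced lambda p v t k.
  split => //; first by rewrite powR_gt0// invr_gt0.
    apply: filterS vpos => g vg; rewrite /t powRM// ?invr_ge0//.
    by rewrite -mulrA uv// mulr1.
  under eq_integral do rewrite EFinM.
  rewrite ge0_integralZl_EFin ?invr_ge0//.
  - by rewrite JE -EFinM mulVf.
  - by move=> g _; rewrite lee_fin.
  - exact/measurable_EFinP.
have et := balanced_energy p1 mv v0 bal.
have int_t : \int[lambda]_g (t g)%:E = 1 by case: bal.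
have too : energy lambda p v t < +oo by rewrite et ltry.
have int_pow_energy phi : cmeasurable phi ->
    int_pow nu p phi = energy lambda p v (fun g => normc (1 - phi g)%R).
  move=> mphi; rewrite int_powE nuE_pow//.
  exact: cmeasurable_normc (cmeasurableB (cmeasurable_cst _ 1%R) mphi).
have dk : d_ p nu S = k%:E.
  apply/eqP; rewrite eq_le -{1}et d_le_mean_one//=.
  apply: le_ereal_inf_tmp => _ [tau Stau <-].
  have mtau := trig_poly_cmeasurable Stau.
  rewrite int_pow_energy//; apply: (balanced_min p1 mv v0 bal).
  - exact: cmeasurable_normc (cmeasurableB (cmeasurable_cst _ 1%R) mtau).
  - by move=> g; exact: normc_ge0.
  - exact: trig_poly_mean.
exists t, k; split => //.
  exists (fun g => (1 - t g)%:C%C); split.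
    by apply: mean_one_closure => //; rewrite nuE_pow.
  have cl : Lp_closure nu p (trig_poly S) (fun g => (1 - t g)%:C%C).
    by apply: mean_one_closure => //; rewrite nuE_pow.
  rewrite int_pow_energy; last exact: Lp_closure_cmeasurable cl.
  rewrite dk -et; apply: eq_integral => g _; congr (_ `^ _ * _)%:E.
  by rewrite -(rmorph1 (real_complex R)) -rmorphB /= subKr expr0n addr0 sqrtr_sqr ger0_norm.
move=> phi [cl]; have mphi := Lp_closure_cmeasurable cl.
rewrite int_pow_energy// dk => ephi; split => //.
apply: (balanced_unique p1 mv v0 bal) => //.
- exact: cmeasurable_normc (cmeasurableB (cmeasurable_cst _ 1%R) mphi).
- by move=> g; exact: normc_ge0.
- exact: closure_mean bal cl.
Qed.

End density.
End projection.

(** * Comparison of two measures *)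

Section main.
Context (R : realType) (G : zmodType).
Local Notation C := R[i]%C.
Local Notation Gamma := (borel (dual R G)).
Local Notation S := [set x : G | x != 0].
Local Open Scope ereal_scope.

Lemma density_of_dominated d (T : measurableType d)
    (lambda : probability T R) (nu : {finite_measure set T -> \bar R}) :
  nu `<< lambda -> exists v : T -> R,
  [/\ forall g, (0 <= v g)%R, measurable_fun setT v &
    forall f : T -> R, measurable_fun setT f -> (forall g, (0 <= f g)%R) ->
      \int[nu]_g (f g)%:E = \int[lambda]_g (f g * v g)%:E].
Proof.
move=> nl; pose F := Radon_Nikodym_SigmaFinite.f nu lambda.
have F0 g : 0 <= F g by exact: Radon_Nikodym_SigmaFinite.f_ge0.
have Ffin g : F g \is a fin_num by exact: Radon_Nikodym_SigmaFinite.f_fin_num.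
have iF : lambda.-integrable setT F by exact: Radon_Nikodym_SigmaFinite.f_integrable.
exists (fun g => fine (F g)); split.
- by move=> g; rewrite fine_ge0.
- apply/measurable_EFinP; rewrite (_ : _ \o _ = F); first by case/integrableP: iF.
  by apply/funext => g /=; rewrite fineK.
- move=> f mf f0.
  rewrite -(Radon_Nikodym_SigmaFinite.change_of_variables nl (f := fun g => (f g)%:E))//.
  + by apply: eq_integral => g _; rewrite EFinM fineK.
  + exact/measurable_EFinP.
Qed.

Lemma integral_scaled_measure d (T : measurableType d) (mu nu : {measure set T -> \bar R})
    (a : R) (f : T -> R) : (0 <= a)%R ->
  (forall A, measurable A -> nu A = a%:E * mu A) ->
  measurable_fun setT f -> (forall g, (0 <= f g)%R) ->
  \int[nu]_g (f g)%:E = a%:E * \int[mu]_g (f g)%:E.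
Proof.
move=> a0 nuE mf f0.
rewrite (eq_measure_integral (mscale (NngNum a0) mu)).
  rewrite ge0_integral_mscale//; first exact/measurable_EFinP.
  by move=> g _; rewrite lee_fin.
by move=> A mA _; rewrite nuE.
Qed.

Lemma d_scaled_measure p (mu nu : {measure set Gamma -> \bar R}) (a : R) (S' : set G) :
  (0 <= a)%R ->
  (forall A, measurable A -> nu A = a%:E * mu A) ->
  a%:E * d_ p mu S' <= d_ p nu S'.
Proof.
move=> a0 nuE; apply: le_ereal_inf_tmp => _ [tau Stau <-].
have mtau := trig_poly_cmeasurable Stau.
rewrite int_powE (integral_scaled_measure a0 nuE).
- by rewrite lee_wpmul2l ?lee_fin//; exact: d_le.
- apply: (measurableT_comp (measurable_powR _)).
  exact: cmeasurable_normc (cmeasurableB (cmeasurable_cst _ 1%R) mtau).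
- by move=> g; exact: powR_ge0.
Qed.

Section zero_distance.
Variables (p : R) (p1 : (1 < p)%R).
Variables (nu : {measure set Gamma -> \bar R}).
Hypothesis nT : nu setT < +oo.
Let p0 : (0 < p)%R. Proof. exact: lt_trans p1. Qed.

(** If d_p(nu; S) = 0 then the constant 1 is a limit of elements of T(S), so a
    projection exists. *)
Lemma metric_proj_d_eq0 (S' : set G) : d_ p nu S' = 0 ->
  is_metric_proj nu p S' (metric_proj nu p S').
Proof.
move=> d0; apply: xgetPex; exists (fun=> 1%R).
split; last first.
  rewrite d0 int_powE; apply: integral0_eq => g _.
  by rewrite subrr normc0 powR0 ?gt_eqF.
split.
  rewrite (_ : (fun=> _) = fun g : Gamma => (1 - 0)%:C%C)%R.
    apply: (complex_Lp_real p1 (h := fun=> 0%R)) => //.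
    under eq_integral do rewrite normr0 powR0 ?gt_eqF//.
    by rewrite integral0 ltry.
  by apply/funext => g; rewrite subr0.
move=> e e0; have ep0 : (0 < e `^ p)%R by rewrite powR_gt0.
have : d_ p nu S' < (e `^ p)%:E by rewrite d0 lte_fin.
move=> /ereal_inf_lt[_ [tau Stau <-] taue]; exists tau => //.
by rewrite Lnorm_lt// => g; exact: normc_ge0.
Qed.

(** The function 1 - phi vanishes nu-almost everywhere, hence mu-almost
    everywhere. *)
Lemma d_cross_eq0 (mu : {measure set Gamma -> \bar R}) (S' : set G) :
  mu `<< nu -> d_ p nu S' = 0 -> d_cross p nu mu S' = 0.
Proof.
move=> munu d0; have [cl] := metric_proj_d_eq0 d0.
rewrite /d_cross; move: (metric_proj _ _ _) cl => phi cl.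
have mphi := Lp_closure_cmeasurable cl.
have m1 : measurable_fun setT (fun g => (normc (1 - phi g)%R `^ p)%:E).
  apply/measurable_EFinP; apply: (measurableT_comp (measurable_powR _)).
  exact: cmeasurable_normc (cmeasurableB (cmeasurable_cst _ 1%R) mphi).
have absE (m : {measure set Gamma -> \bar R}) :
    int_pow m p phi = \int[m]_g `|(normc (1 - phi g)%R `^ p)%:E|.
  by apply: eq_integral => g _; rewrite gee0_abs// lee_fin powR_ge0.
rewrite d0 !absE => /(ae_eq_integral_abs nu measurableT m1) ae0.
apply/(ae_eq_integral_abs mu measurableT m1).
exact: null_dominates_ae_eq ae0.
Qed.

End zero_distance.

(** Here e_x is the constant 1, and it belongs to T(S). *)
Lemma d_eq0_trivial_character p (m : {measure set Gamma -> \bar R}) (S' : set G) x :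
  (0 < p)%R -> S' x -> (forall g : dual R G, pairing g x = 1%R) ->
  d_ p m S' = 0.
Proof.
move=> p0 Sx x1; apply/eqP; rewrite eq_le d_ge0 andbT.
have T1 : trig_poly S' (fun g => 1 * @e_ R G x g + 0)%R.
  by apply: trig_poly_cons => //; exact: trig_poly0.
apply: (le_trans (d_le m p T1)); rewrite int_powE integral0_eq// => g _.
by rewrite /Defs.e_ x1 mulr1 addr0 subrr normc0 powR0 ?gt_eqF.
Qed.

End main.

Local Open Scope ereal_scope.

Theorem theorem4p9 (R : realType) (G : zmodType)
    (G_nontrivial : exists x : G, x != 0%R)
    (lambda : probability (borel (dual R G)) R) (haar_lambda : is_haar lambda)
    (p : R) (p_gt1 : (1 < p)%R)
    (mu nu : {finite_measure set (borel (dual R G)) -> \bar R})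
    (M_mu : class_M mu) (M_nu : class_M nu)
    (mu_lambda : mu `<< lambda) (nu_lambda : nu `<< lambda)
    (mu_nu : mu `<< nu) :
  let S := [set x : G | x != 0%R] in
  (d_cross p nu mu S = 0 \/
   d_ p mu S <= d_cross p nu mu S <= +oo) /\
  (0 < d_ p mu S ->
   (d_ p mu S = d_cross p nu mu S <->
    exists2 a : R, (0 < a)%R &
      forall A : set (borel (dual R G)), measurable A ->
        nu A = a%:E * mu A)).
Proof.
move=> S; have p0 : (0 < p)%R by rewrite (lt_trans _ p_gt1).
have fin (m : {finite_measure set (borel (dual R G)) -> \bar R}) : m setT < +oo.
  by rewrite ltey_eq fin_num_measure.
(* If all characters are trivial at some x <> 0, then 1 = e_x lies in T(S) and
   every distance vanishes. *)
have [sep|nsep] :=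
    pselect (forall x : G, x != 0%R -> exists g : dual R G, pairing g x != 1%R);
  last first.
  have [x [x0 x1]] : exists x : G, x != 0%R /\ forall g : dual R G, pairing g x = 1%R.
    move: nsep => /existsNP[x /not_implyP[x0 /forallNP x1]].
    by exists x; split => // g; have /negP := x1 g; rewrite negbK => /eqP.
  have dz (m : {finite_measure set (borel (dual R G)) -> \bar R}) : d_ p m S = 0.
    exact: (d_eq0_trivial_character m p0 (x0 : S x) x1).
  by split; [left; exact: (d_cross_eq0 p_gt1 (fin nu) mu_nu (dz nu))|rewrite dz ltxx].
have [v [v0 mv nuE]] := density_of_dominated nu_lambda.
have [w [w0 mw muE]] := density_of_dominated mu_lambda.
have [reg_nu _] := M_nu; have [reg_mu _] := M_mu.
have specmu := projection_spec haar_lambda sep p_gt1 (fin mu) reg_mu w0 mw muE.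
have scale_pos a : (0 < a)%R -> (forall A, measurable A -> nu A = a%:E * mu A) ->
    0 < d_ p mu S -> 0 < d_ p nu S.
  move=> a0 sc dmu; apply: lt_le_trans (d_scaled_measure p S (ltW a0) sc).
  by rewrite mule_gt0 ?lte_fin.
(* The projection of nu is 1 nu-almost everywhere when d_p(nu; S) = 0. *)
have [dnu0|dnu_neq0] := eqVneq (d_ p nu S) 0.
  have cross0 := d_cross_eq0 p_gt1 (fin nu) mu_nu dnu0.
  split; [by left|move=> dmu; rewrite cross0; split].
    by move=> dmu0; rewrite dmu0 ltxx in dmu.
  by move=> [a a0 sc]; have := scale_pos a a0 sc dmu; rewrite dnu0 ltxx.
have dnu_pos : 0 < d_ p nu S by rewrite lt0e dnu_neq0 d_ge0.
have [t [k [balt dnuk projex projt]]] :=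
  projection_spec haar_lambda sep p_gt1 (fin nu) reg_nu v0 mv nuE dnu_pos.
pose phi := metric_proj nu p S.
have projphi : is_metric_proj nu p S phi by exact: xgetPex.
have [mphi phit] := projt phi projphi.
have m1phi := cmeasurable_normc (cmeasurableB (cmeasurable_cst _ 1%R) mphi).
have [mt t0 k0 tvk intt] := balt.
have cross_energy : d_cross p nu mu S = energy lambda p w t.
  rewrite /d_cross -/phi int_powE muE; last 2 first.
  - exact: (measurableT_comp (measurable_powR _)).
  - by move=> g; exact: powR_ge0.
  apply: ge0_ae_eq_integral => //.
  - exact: measurable_energy.
  - exact: measurable_energy.
  - by move=> g _; rewrite lee_fin mulr_ge0// powR_ge0.
  - by move=> g _; rewrite lee_fin mulr_ge0// powR_ge0.
  by move: phit; apply: filterS => g -> _.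
have t1 : 1 <= \int[lambda]_g (t g)%:E by rewrite intt.
split.
  right; rewrite leey andbT.
  have [->|dmu_neq0] := eqVneq (d_ p mu S) 0; first exact: int_pow_ge0.
  have dmu_pos : 0 < d_ p mu S by rewrite lt0e dmu_neq0 d_ge0.
  have [t' [k' [balt' -> _ _]]] := specmu dmu_pos.
  by rewrite cross_energy; exact: balanced_min balt' _ _ _ _.
move=> dmu_pos; have [t' [k' [balt' dmuk _ _]]] := specmu dmu_pos.
have [_ _ k'0 twk _] := balt'.
split.
  rewrite cross_energy dmuk => /esym et.
  have tt' := balanced_unique p_gt1 mw w0 balt' mt t0 t1 et.
  (* t^(p-1) v = k and t^(p-1) w = k' with the same t *)
  have vw : {ae lambda, forall g, v g = (k / k' * w g)%R}.
    move: tvk twk tt'; apply: filterS3 => g tv tw ttg.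
    have [tg _ _] := balancedP p_gt1 (t0 g) (v0 g) k0 tv.
    rewrite -ttg in tw.
    have tp : (t g `^ (p - 1) != 0)%R by rewrite gt_eqF// powR_gt0.
    apply: (mulfI tp); rewrite tv.
    by rewrite mulrCA tw divfK// gt_eqF.
  exists (k / k')%R; first by rewrite divr_gt0.
  move=> A mA.
  have intA (m : {measure set (borel (dual R G)) -> \bar R}) :
      m A = \int[m]_g (\1_A g)%:E.
    by rewrite integral_indic// setIT.
  have k00 : (0 <= k / k')%R by rewrite divr_ge0 ?ltW.
  rewrite (intA nu) (intA mu) nuE// muE// -ge0_integralZl_EFin//; last 2 first.
  - by move=> g _; rewrite lee_fin mulr_ge0.
  - by apply/measurable_EFinP; exact: measurable_funM.
  apply: ge0_ae_eq_integral => //.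
  - by apply/measurable_EFinP; exact: measurable_funM.
  - by apply: measurable_funeM; apply/measurable_EFinP; exact: measurable_funM.
  - by move=> g _; rewrite lee_fin mulr_ge0.
  - by move=> g _; rewrite -EFinM lee_fin mulr_ge0// mulr_ge0.
  by move: vw; apply: filterS => g -> _; rewrite -EFinM mulrCA.
move=> [a a0 sc].
have sc' A : measurable A -> mu A = a^-1%:E * nu A.
  by move=> mA; rewrite sc// muleA -EFinM mulVf ?gt_eqF// mul1e.
have aV0 : (0 <= a^-1)%R by rewrite invr_ge0 ltW.
have cross_scale : d_cross p nu mu S = a^-1%:E * d_ p nu S.
  have [_ <-] := projphi.
  rewrite /d_cross -/phi !int_powE (integral_scaled_measure aV0 sc')//.
  - exact: (measurableT_comp (measurable_powR _)).
  - by move=> g; exact: powR_ge0.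
apply/eqP; rewrite eq_le; apply/andP; split.
  rewrite cross_scale; have := d_scaled_measure p S (ltW a0) sc.
  rewrite dmuk dnuk -!EFinM !lee_fin => h.
  by rewrite mulrC ler_pdivlMr// mulrC.
by rewrite cross_scale; exact: d_scaled_measure aV0 sc'.
Qed.
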